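(* Let $\Delta\in\{1,2,\dots\}$ and let $s\in\mathbb{C}$ with $s\neq 1$. Then $$\zeta(s)=\sum_{k=\Delta}^{\infty}\binom{s+k-1}{k}\frac{\zeta(s+k)}{2^{k}}\sum_{j=0}^{\Delta-1}\frac{B_j}{2^{s}-2^{1-j}}\sum_{i=j}^{\Delta-1}\binom{k}{i}\binom{i+1}{j}\frac{1}{i+1}.$$ Here, at those $s\neq 1$ for which some term of the right-hand side is undefined (because $s+k=1$ for some $k\ge\Delta$, or because $2^s=2^{1-j}$ for some $0\le j\le\Delta-1$), the right-hand side is understood as its limit as $s'\to s$ through points $s'$ at which all terms are defined.
   Context: $\zeta$ denotes the Riemann zeta function, meromorphically continued to $\mathbb{C}$ with its only pole (simple, residue $1$) at $1$. $B_j$ are the Bernoulli numbers with $B_0=1$, $B_1=-\tfrac12$, $B_2=\tfrac16$, and $\sum_{k=0}^{m}\binom{m+1}{k}B_k=0$ for $m\ge 1$. For $z\in\mathbb{C}$ and an integer $n\ge 0$, $\binom{z}{n}=\frac{z(z-1)\cdots(z-n+1)}{n!}$ is the generalized binomial coefficient (equal to $1$ for $n=0$). $2^s=e^{s\ln 2}$. *)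

(* Defs.v *)
From Stdlib Require Import Reals Lra Lia Arith.
From Coquelicot Require Import Coquelicot.

Open Scope C_scope.

Definition Cexp (z : C) : C :=
  (exp (Re z) * cos (Im z), exp (Re z) * sin (Im z))%R.

(* [x ^ s], only meaningful for a positive real base [x]. *)
Definition Rcpow (x : R) (s : C) : C := Cexp (s * RtoC (ln x)).

(* z (z - 1) ... (z - n + 1) *)
Fixpoint Cfalling (z : C) (n : nat) : C :=
  match n with
  | O => 1
  | S n' => Cfalling z n' * (z - RtoC (INR n'))
  end.

Definition Cbinom (z : C) (n : nat) : C := Cfalling z n / RtoC (INR (fact n)).

(* [bernoulli_upto m] agrees with the Bernoulli numbers on [0 .. m] and is
   junk beyond; each step solves
   sum_(k <= m) binom (m + 1) k * B_k = 0 for the last unknown B_m, whose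
   coefficient is m + 1. *)
Fixpoint bernoulli_upto (m : nat) : nat -> R :=
  match m with
  | O => fun _ => 1%R
  | S m' => fun k =>
      if (k <=? m')%nat then bernoulli_upto m' k
      else (- (sum_f_R0 (fun i => Binomial.C (S m) i * bernoulli_upto m' i) m')
            / INR (S m))%R
  end.

Definition bernoulli (m : nat) : R := bernoulli_upto m m.

Lemma bernoulli_upto_eq (m k : nat) :
  (k <= m)%nat -> bernoulli_upto m k = bernoulli k.
Proof.
induction m as [|m IH]; intros Hk.
- now replace k with O by lia.
- destruct (Nat.leb_spec k m) as [H|H].
  + cbn [bernoulli_upto]. rewrite (proj2 (Nat.leb_le k m) H). now apply IH.
  + replace k with (S m) by lia.
    reflexivity.
Qed.

Lemma bernoulli_0 : bernoulli 0 = 1%R.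
Proof. reflexivity. Qed.

Lemma bernoulli_rec (m : nat) : (1 <= m)%nat ->
  sum_f_R0 (fun k => Binomial.C (m + 1) k * bernoulli k)%R m = 0%R.
Proof.
intros Hm. destruct m as [|m]; [lia|].
rewrite Nat.add_1_r, tech5.
assert (HB : bernoulli (S m) =
  (- (sum_f_R0 (fun i => Binomial.C (S (S m)) i * bernoulli_upto m i) m)
   / INR (S (S m)))%R).
{ unfold bernoulli at 1; cbn [bernoulli_upto].
  now rewrite (proj2 (Nat.leb_gt (S m) m) (Nat.lt_succ_diag_r m)). }
assert (HC : Binomial.C (S (S m)) (S m) = INR (S (S m))).
{ unfold Binomial.C. replace (S (S m) - S m)%nat with 1%nat by lia.
  rewrite (fact_simpl (S m)), mult_INR. change (INR (fact 1)) with 1%R.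
  field. apply INR_fact_neq_0. }
rewrite HB, HC.
rewrite (sum_eq (fun k => Binomial.C (S (S m)) k * bernoulli k)%R
                (fun k => Binomial.C (S (S m)) k * bernoulli_upto m k)%R).
- field. now apply not_0_INR.
- intros i Hi. now rewrite bernoulli_upto_eq.
Qed.

Lemma bernoulli_1 : bernoulli 1 = (- (1 / 2))%R.
Proof. unfold bernoulli; simpl; unfold Binomial.C; simpl; field. Qed.

Lemma bernoulli_2 : bernoulli 2 = (1 / 6)%R.
Proof. unfold bernoulli; simpl; unfold Binomial.C; simpl; field. Qed.

(* [zeta] is the meromorphic continuation of the Dirichlet series
   sum_(n >= 1) n ^ (- s): it is complex differentiable on C \ {1} with a simple
   pole of residue 1 at 1.  By the identity theorem this determines [zeta] on
   C \ {1}; the value at the pole is arbitrary. *)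
Record is_riemann_zeta (zeta : C -> C) : Prop := {
  zeta_dirichlet : forall s : C, (1 < Re s)%R ->
    is_series (K := C_AbsRing) (V := C_NormedModule)
      (fun n : nat => Rcpow (INR (S n)) (- s)) (zeta s);
  zeta_holomorphic : forall s : C, s <> 1 ->
    ex_derive (K := C_AbsRing) (V := C_NormedModule) zeta s;
  zeta_residue :
    filterlim (U := C_UniformSpace) (fun s : C => (s - 1) * zeta s)
      (locally' (T := C_UniformSpace) (RtoC 1))
      (locally (T := C_UniformSpace) (RtoC 1))
}.

Definition rhs_term (zeta : C -> C) (Delta : nat) (s : C) (k : nat) : C :=
  Cbinom (s + RtoC (INR k) - 1) k * (zeta (s + RtoC (INR k)) / 2 ^ k)
  * sum_n (G := C_AbelianMonoid) (fun j : nat =>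
      RtoC (bernoulli j) / (Rcpow 2 s - Rcpow 2 (1 - RtoC (INR j)))
      * sum_n_m (G := C_AbelianMonoid) (fun i : nat =>
          Cbinom (RtoC (INR k)) i * Cbinom (RtoC (INR (i + 1))) j
          * (1 / RtoC (INR (i + 1)))) j (Delta - 1))
      (Delta - 1).

Definition rhs_defined (Delta : nat) (s : C) : Prop :=
  (forall k : nat, (Delta <= k)%nat -> s + RtoC (INR k) <> 1) /\
  (forall j : nat, (j <= Delta - 1)%nat ->
     Rcpow 2 s <> Rcpow 2 (1 - RtoC (INR j))).

Definition is_rhs_sum (zeta : C -> C) (Delta : nat) (s v : C) : Prop :=
  is_series (K := C_AbsRing) (V := C_NormedModule)
    (fun n : nat => rhs_term zeta Delta s (Delta + n)) v.

(* Main.v *)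
Require Import Defs.
From Stdlib Require Import Reals Lra Lia Arith IndefiniteDescription.
From Coquelicot Require Import Coquelicot.

(** Write c(s,k) = s(s+1)...(s+k-1)/k!, the coefficient of x^k in (1-x)^(-s), so
    that binom(s+k-1, k) = c(s,k). Everything rests on the half-shift formula

      sum_(m >= 0) c(s,m) zeta(s+m) / 2^m = (2^s - 1) zeta(s),

    valid as soon as s + m <> 1 for all m >= 0 ([zeta_half_shift]).

    For Re s >= 2 one expands zeta(s+m) as a Dirichlet series and sums over m
    first: the left side becomes the sum over n >= 1 of
    n^(-s) (1 - 1/(2n))^(-s) = (n - 1/2)^(-s), that is 2^s times the part of the
    Dirichlet series of zeta(s) with odd denominators, and this part is
    (1 - 2^(-s)) zeta(s). The exchange of summations is legitimate because the
    binomial series converges uniformly on [0, 1/2]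
    ([binomial_series_uniform], [half_shift_defect_right]).

    The formula extends to other s by uniqueness of analytic continuation. The
    difference of the two sides, truncated at m = N, is holomorphic away from
    the real axis, and these truncations are uniformly Cauchy on bounded sets,
    since zeta(s+m) is bounded for large m and c(s,m) = O((3/2)^m). What has to
    be proved is that holomorphic functions with this property which tend to 0
    on Re s >= 2 tend to 0 on the whole upper (or lower) half-plane
    ([tends_to_0_half_plane]). Zeta is only assumed to be complex
    differentiable, so the proof starts from Goursat's theorem
    ([goursat_circulation]). Goursat's theorem in the coordinate
    t -> w + r e^t gives the bound of |g(w)| by the maximum of |g| over a
    circle centred at w ([Cmod_center_le_circle]). Multiplying g by a power of
    a holomorphic function that equals 1 at w and is smaller than 1 in modulus
    on a large part of the circle shows that smallness on the remaining arc
    forces smallness at w ([tends_to_0_center]), and vanishing then spreads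
    through wedges of growing aperture. Real s are reached by continuity; no
    path around a pole is ever needed.

    The theorem follows by linear algebra. Let
    weight(j) = B_j / (2^s - 2^(1-j)) and
    b(i) = sum_(j <= i) weight(j) binom(i+1, j) / (i+1). The factor multiplying
    c(s,k) zeta(s+k) / 2^k in the theorem is
    P(k) = sum_(i < Delta) binom(k,i) b(i) ([rhs_factor_expansion]), and the
    half-shift formula at s+i gives

      sum_(k >= 0) c(s,k) binom(k,i) zeta(s+k) / 2^k
        = c(s,i) (2^s - 2^(-i)) zeta(s+i)

    ([is_Cseries_binomial_moment]). So the sum over all k >= 0, weighted by P(k),
    is the sum over i < Delta of b(i) c(s,i) (2^s - 2^(-i)) zeta(s+i). Removing
    the terms k < Delta leaves, for each k < Delta, c(s,k) zeta(s+k) times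
    b(k) (2^s - 2^(-k)) - P(k) / 2^k. In this difference the factor
    2^s - 2^(1-j) cancels the denominator of weight(j), and the recursion of
    the Bernoulli numbers makes it 1 for k = 0 and 0 otherwise
    ([bernoulli_cancellation]). Only zeta(s) survives.

    At the exceptional points the limit is that of zeta itself, which is
    continuous there. *)
Open Scope C_scope.

(** * Goursat's theorem for real differential forms on a rectangle *)

Section RealForms.
Local Open Scope R_scope.

(** Bisection: the lower left corners of nested cells increase, the upper
    right ones decrease, so the supremum of the former lies in every cell. *)
Lemma nested_cells (W H x0 y0 : R) (bad : nat -> R -> R -> Prop) :
  bad O x0 y0 ->
  (forall n x y, bad n x y -> exists x' y',
     (x <= x' <= x + W / 2 ^ S n) /\ (y <= y' <= y + H / 2 ^ S n) /\ bad (S n) x' y') ->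
  exists X Y, forall n, exists x y,
    bad n x y /\ (x0 <= x <= X /\ X <= x + W / 2 ^ n <= x0 + W) /\
    (y0 <= y <= Y /\ Y <= y + H / 2 ^ n <= y0 + H).
Proof.
intros H0 Hstep.
assert (next : forall n (c : R * R), bad n (fst c) (snd c) ->
   {c' : R * R | (fst c <= fst c' <= fst c + W / 2 ^ S n) /\
      (snd c <= snd c' <= snd c + H / 2 ^ S n) /\ bad (S n) (fst c') (snd c')}).
{ intros n c Hc. apply constructive_indefinite_description.
  destruct (Hstep n _ _ Hc) as (x' & y' & Hxy). now exists (x', y'). }
set (cells := fix cells n : {c : R * R | bad n (fst c) (snd c)} :=
   match n with
   | O => exist _ (x0, y0) H0
   | S n' => let (c, Hc) := cells n' in
       let (c', Hc') := next n' c Hc in exist _ c' (proj2 (proj2 Hc'))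
   end).
set (u n := fst (proj1_sig (cells n))).
set (v n := snd (proj1_sig (cells n))).
assert (Huv : forall n, (u n <= u (S n) <= u n + W / 2 ^ S n) /\
                        (v n <= v (S n) <= v n + H / 2 ^ S n)).
{ intros n. unfold u, v. simpl cells. destruct (cells n) as [c Hc].
  destruct (next n c Hc) as [c' Hc']. simpl proj1_sig. tauto. }
assert (lim : forall (a : nat -> R) L a0, a O = a0 ->
   (forall n, a n <= a (S n) <= a n + L / 2 ^ S n) ->
   exists A, forall n, a0 <= a n <= A /\ A <= a n + L / 2 ^ n <= a0 + L).
{ intros a L a0 Ha0 Ha.
  assert (Hinc : forall n m, (n <= m)%nat -> a n <= a m).
  { induction 1; [lra|]. generalize (Ha m); lra. }
  assert (Hdec : forall n m, (n <= m)%nat -> a m + L / 2 ^ m <= a n + L / 2 ^ n).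
  { induction 1 as [|m Hm IH]; [lra|]. generalize (Ha m).
    replace (L / 2 ^ m) with (L / 2 ^ S m + L / 2 ^ S m) in IH; [lra|].
    simpl. field. apply pow_nonzero; lra. }
  assert (Hub : forall n m, a m <= a n + L / 2 ^ n).
  { intros n m.
    assert (Hw : forall k, 0 <= L / 2 ^ S k) by (intros k; generalize (Ha k); lra).
    destruct (Nat.le_ge_cases n m) as [Hm|Hm].
    - generalize (Hdec n m Hm), (Hw m).
      replace (L / 2 ^ m) with (2 * (L / 2 ^ S m));
        [lra | simpl; field; apply pow_nonzero; lra].
    - generalize (Hinc m n Hm), (Hw n).
      replace (L / 2 ^ n) with (2 * (L / 2 ^ S n));
        [lra | simpl; field; apply pow_nonzero; lra]. }
  destruct (completeness (fun r => exists n, r = a n)) as [A [HA1 HA2]].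
  - exists (a O + L / 2 ^ 0). intros r [n ->]. apply Hub.
  - exists (a O), O; reflexivity.
  - exists A. intros n. repeat split.
    + rewrite <- Ha0. apply Hinc. lia.
    + apply HA1. now exists n.
    + apply HA2. intros r [m ->]. apply Hub.
    + generalize (Hdec O n ltac:(lia)). simpl. rewrite Ha0. lra. }
destruct (lim u W x0 eq_refl (fun n => proj1 (Huv n))) as [X HX].
destruct (lim v H y0 eq_refl (fun n => proj2 (Huv n))) as [Y HY].
exists X, Y. intros n. exists (u n), (v n). repeat split; try apply HX; try apply HY.
apply (proj2_sig (cells n)).
Qed.

Lemma RInt_near_const (f : R -> R) (a w m e : R) :
  0 <= w -> ex_RInt f a (a + w) ->
  (forall t, a <= t <= a + w -> Rabs (f t - m) <= e) ->
  Rabs (RInt f a (a + w) - m * w) <= e * w.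
Proof.
intros Hw Hf Hb.
assert (H1 : RInt (fun _ => m - e) a (a + w) <= RInt f a (a + w)).
{ apply RInt_le; [lra | apply ex_RInt_const | assumption |].
  intros t Ht. generalize (Hb t ltac:(lra)). intros; apply Rabs_le_between in H. lra. }
assert (H2 : RInt f a (a + w) <= RInt (fun _ => m + e) a (a + w)).
{ apply RInt_le; [lra | assumption | apply ex_RInt_const |].
  intros t Ht. generalize (Hb t ltac:(lra)). intros; apply Rabs_le_between in H. lra. }
rewrite RInt_const in H1, H2. unfold scal in H1, H2; simpl in H1, H2.
unfold mult in H1, H2; simpl in H1, H2.
apply Rabs_le_between. split; nra.
Qed.

(** The integral of p dx + q dy around the rectangle [x, x+w] x [y, y+h],
    counterclockwise. *)
Definition circulation (p q : R -> R -> R) (x y w h : R) : R :=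
  RInt (fun t => p t y) x (x + w) + RInt (fun t => q (x + w) t) y (y + h)
  - RInt (fun t => p t (y + h)) x (x + w) - RInt (fun t => q x t) y (y + h).

Lemma differentiable_pt_lim_slice_continuous (p : R -> R -> R) (x y lx ly : R) :
  differentiable_pt_lim p x y lx ly ->
  continuous (fun t => p t y) x /\ continuous (fun t => p x t) y.
Proof.
intros Hd.
assert (Hc : continuity_2d_pt p x y)
  by (apply differentiable_continuity_pt; now exists lx, ly).
split; apply continuity_pt_filterlim; intros eps Heps.
all: destruct (Hc (mkposreal eps Heps)) as [d Hdd].
all: exists d; split; [apply cond_pos|]; intros t [_ Ht].
all: apply Hdd; try exact Ht.
all: rewrite Rminus_diag, Rabs_R0; apply cond_pos.
Qed.

Section Goursat.
Variables (p q : R -> R -> R) (x0 y0 W H : R).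
Hypotheses (HW : 0 <= W) (HH : 0 <= H).
Hypothesis closed_form : forall x y, x0 <= x <= x0 + W -> y0 <= y <= y0 + H ->
  exists lx k ly, differentiable_pt_lim p x y lx k /\ differentiable_pt_lim q x y k ly.

Let inside x y w h := x0 <= x /\ 0 <= w /\ x + w <= x0 + W /\
                      y0 <= y /\ 0 <= h /\ y + h <= y0 + H.

Lemma ex_RInt_horizontal x w y :
  x0 <= x -> 0 <= w -> x + w <= x0 + W -> y0 <= y <= y0 + H ->
  ex_RInt (fun t => p t y) x (x + w).
Proof.
intros. apply (ex_RInt_continuous (V := R_CompleteNormedModule)).
rewrite Rmin_left, Rmax_right by lra. intros t Ht.
destruct (closed_form t y) as (lx & k & ly & Hp & _); try lra.
apply (differentiable_pt_lim_slice_continuous _ _ _ _ _ Hp).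
Qed.

Lemma ex_RInt_vertical y h x :
  y0 <= y -> 0 <= h -> y + h <= y0 + H -> x0 <= x <= x0 + W ->
  ex_RInt (fun t => q x t) y (y + h).
Proof.
intros. apply (ex_RInt_continuous (V := R_CompleteNormedModule)).
rewrite Rmin_left, Rmax_right by lra. intros t Ht.
destruct (closed_form x t) as (lx & k & ly & _ & Hq); try lra.
apply (differentiable_pt_lim_slice_continuous _ _ _ _ _ Hq).
Qed.

Lemma circulation_quarters x y w h :
  inside x y (w + w) (h + h) ->
  circulation p q x y (w + w) (h + h) =
  circulation p q x y w h + circulation p q (x + w) y w h
  + circulation p q x (y + h) w h + circulation p q (x + w) (y + h) w h.
Proof.
intros (?&?&?&?&?&?). unfold circulation.
rewrite <- !Rplus_assoc.
assert (HA : forall z, y0 <= z <= y0 + H -> RInt (fun t => p t z) x (x + w + w) =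
   RInt (fun t => p t z) x (x + w) + RInt (fun t => p t z) (x + w) (x + w + w)).
{ intros z Hz. symmetry. apply (RInt_Chasles (V := R_CompleteNormedModule));
   apply ex_RInt_horizontal; lra. }
assert (HB : forall z, x0 <= z <= x0 + W -> RInt (fun t => q z t) y (y + h + h) =
   RInt (fun t => q z t) y (y + h) + RInt (fun t => q z t) (y + h) (y + h + h)).
{ intros z Hz. symmetry. apply (RInt_Chasles (V := R_CompleteNormedModule));
   apply ex_RInt_vertical; lra. }
rewrite !HA, !HB by lra. ring.
Qed.

(** The affine parts of p and q contribute - k h w and k w h, which cancel
    because the y-derivative of p equals the x-derivative of q. Only the
    first-order remainders are left; each is at most eps (w + h) on a
    perimeter of length 2 (w + h). *)
Lemma circulation_local X Y eps :
  x0 <= X <= x0 + W -> y0 <= Y <= y0 + H -> 0 < eps ->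
  exists delta, 0 < delta /\ forall x y w h, inside x y w h ->
    x <= X <= x + w -> y <= Y <= y + h -> w < delta -> h < delta ->
    Rabs (circulation p q x y w h) <= 4 * eps * (w + h) ^ 2.
Proof.
intros HX HY Heps.
destruct (closed_form X Y HX HY) as (lx & k & ly & Hp & Hq).
destruct (Hp (mkposreal eps Heps)) as [d1 Hd1].
destruct (Hq (mkposreal eps Heps)) as [d2 Hd2].
simpl in Hd1, Hd2.
exists (Rmin d1 d2). split; [apply Rmin_pos; apply cond_pos|].
intros x y w h Hin Hx Hy Hw Hh.
assert (Hw1 := Rlt_le_trans _ _ _ Hw (Rmin_l d1 d2)).
assert (Hw2 := Rlt_le_trans _ _ _ Hw (Rmin_r d1 d2)).
assert (Hh1 := Rlt_le_trans _ _ _ Hh (Rmin_l d1 d2)).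
assert (Hh2 := Rlt_le_trans _ _ _ Hh (Rmin_r d1 d2)).
assert (close : forall (f : R -> R -> R) a b (d : posreal), w < d -> h < d ->
  (forall u v, Rabs (u - X) < d -> Rabs (v - Y) < d ->
     Rabs (f u v - f X Y - (a * (u - X) + b * (v - Y)))
       <= eps * Rmax (Rabs (u - X)) (Rabs (v - Y))) ->
  forall u v, x <= u <= x + w -> y <= v <= y + h ->
     Rabs (f u v - f X Y - (a * (u - X) + b * (v - Y))) <= eps * (w + h)).
{ intros f a b d Hwd Hhd Hf u v Hu Hv.
  assert (Rabs (u - X) <= w) by (apply Rabs_le_between; lra).
  assert (Rabs (v - Y) <= h) by (apply Rabs_le_between; lra).
  eapply Rle_trans; [apply Hf; lra|]. apply Rmult_le_compat_l; [lra|].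
  apply Rmax_lub; lra. }
assert (Cp := close p lx k d1 Hw1 Hh1 Hd1).
assert (Cq := close q k ly d2 Hw2 Hh2 Hd2).
destruct Hin as (?&?&?&?&?&?).
assert (E1 : Rabs (RInt (fun t => p t y - p t (y + h)) x (x + w) - (- k * h) * w)
              <= 2 * eps * (w + h) * w).
{ apply RInt_near_const; [assumption| |].
  - apply (ex_RInt_minus (V := R_NormedModule)); apply ex_RInt_horizontal; lra.
  - intros t Ht. generalize (Cp t y Ht ltac:(lra)), (Cp t (y + h) Ht ltac:(lra)).
    intros A B. apply Rabs_le_between in A. apply Rabs_le_between in B.
    apply Rabs_le_between. lra. }
assert (E2 : Rabs (RInt (fun t => q (x + w) t - q x t) y (y + h) - (k * w) * h)
              <= 2 * eps * (w + h) * h).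
{ apply RInt_near_const; [assumption| |].
  - apply (ex_RInt_minus (V := R_NormedModule)); apply ex_RInt_vertical; lra.
  - intros t Ht. generalize (Cq x t ltac:(lra) Ht), (Cq (x + w) t ltac:(lra) Ht).
    intros A B. apply Rabs_le_between in A. apply Rabs_le_between in B.
    apply Rabs_le_between. lra. }
rewrite (RInt_minus (V := R_CompleteNormedModule)) in E1
  by (apply ex_RInt_horizontal; lra).
rewrite (RInt_minus (V := R_CompleteNormedModule)) in E2
  by (apply ex_RInt_vertical; lra).
unfold circulation, minus, plus, opp in *; simpl in E1, E2.
apply Rabs_le_between in E1. apply Rabs_le_between in E2.
apply Rabs_le_between.
assert (0 <= eps * (w + h) ^ 2).
{ apply Rmult_le_pos; [lra|]. apply pow_le. lra. }
simpl in *.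
set (A := RInt (fun t => p t y) x (x + w)) in *.
set (B := RInt (fun t => p t (y + h)) x (x + w)) in *.
set (A' := RInt (fun t => q x t) y (y + h)) in *.
set (B' := RInt (fun t => q (x + w) t) y (y + h)) in *.
split; lra.
Qed.

(** Partial derivatives are not assumed continuous, so Green's formula does
    not apply. If the circulation were c <> 0, quartering would give nested
    cells of circulation at least |c| / 4^n, while near their common point the
    circulation is o(1 / 4^n). *)
Lemma goursat_circulation : circulation p q x0 y0 W H = 0.
Proof.
destruct (Req_dec (circulation p q x0 y0 W H) 0) as [|Hne]; [assumption|exfalso].
set (c := Rabs (circulation p q x0 y0 W H)).
assert (Hc : 0 < c) by now apply Rabs_pos_lt.
destruct (nested_cells W H x0 y0 (fun n x y =>
   inside x y (W / 2 ^ n) (H / 2 ^ n) /\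
   c / 4 ^ n <= Rabs (circulation p q x y (W / 2 ^ n) (H / 2 ^ n))))
  as (X & Y & HXY).
- simpl. replace (W / 1) with W by field. replace (H / 1) with H by field.
  split; [unfold inside; lra|]. unfold c. lra.
- intros n x y [Hin Hbad].
  set (w := W / 2 ^ S n). set (h := H / 2 ^ S n).
  assert (H2n : 0 < 2 ^ n) by (apply pow_lt; lra).
  assert (H4n : 0 < 4 ^ n) by (apply pow_lt; lra).
  assert (Hw : W / 2 ^ n = w + w) by (unfold w; simpl; field; lra).
  assert (Hh : H / 2 ^ n = h + h) by (unfold h; simpl; field; lra).
  assert (Hc4 : c / 4 ^ n = 4 * (c / 4 ^ S n)) by (simpl; field; lra).
  rewrite Hw, Hh in Hin, Hbad. rewrite Hc4 in Hbad.
  rewrite (circulation_quarters _ _ _ _ Hin) in Hbad.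
  unfold inside in *.
  (* The four quarters share the circulation, so one of them carries a quarter
     of it. *)
  destruct (Rle_lt_dec (c / 4 ^ S n) (Rabs (circulation p q x y w h))) as [A|A];
    [exists x, y; repeat split; (assumption || lra)|].
  destruct (Rle_lt_dec (c / 4 ^ S n) (Rabs (circulation p q (x + w) y w h))) as [B|B];
    [exists (x + w), y; repeat split; (assumption || lra)|].
  destruct (Rle_lt_dec (c / 4 ^ S n) (Rabs (circulation p q x (y + h) w h))) as [D|D];
    [exists x, (y + h); repeat split; (assumption || lra)|].
  destruct (Rle_lt_dec (c / 4 ^ S n) (Rabs (circulation p q (x + w) (y + h) w h))) as [E|E];
    [exists (x + w), (y + h); repeat split; (assumption || lra)|].
  exfalso. revert Hbad.
  set (c1 := circulation p q x y w h) in *.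
  set (c2 := circulation p q (x + w) y w h) in *.
  set (c3 := circulation p q x (y + h) w h) in *.
  set (c4 := circulation p q (x + w) (y + h) w h) in *.
  generalize (Rabs_triang (c1 + c2 + c3) c4), (Rabs_triang (c1 + c2) c3), (Rabs_triang c1 c2).
  lra.
(* With this value, 4 eps (W + H)^2 < c, which contradicts the lower bound. *)
- set (eps := c / (8 * ((W + H) ^ 2 + 1))).
  assert (HS : 0 <= (W + H) ^ 2) by (apply pow_le; lra).
  assert (Heps : 0 < eps) by (apply Rdiv_lt_0_compat; lra).
  assert (HX : x0 <= X <= x0 + W).
  { destruct (HXY O) as (x & y & _ & Hx & _). lra. }
  assert (HY : y0 <= Y <= y0 + H).
  { destruct (HXY O) as (x & y & _ & _ & Hy). lra. }
  destruct (circulation_local X Y eps HX HY Heps) as (d & Hd & Hloc).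
  assert (small : exists n, (W + H) / 2 ^ n < d).
  { destruct (pow_lt_1_zero (/ 2) ltac:(rewrite Rabs_pos_eq; lra) (d / (W + H + 1)))
      as [n Hn]. apply Rdiv_lt_0_compat; lra.
    exists n. specialize (Hn n (Nat.le_refl n)).
    assert (0 < / 2 ^ n) by (apply Rinv_0_lt_compat, pow_lt; lra).
    rewrite pow_inv, Rabs_pos_eq in Hn by lra.
    unfold Rdiv. apply (Rmult_lt_compat_r (W + H + 1)) in Hn; [|lra].
    replace (d / (W + H + 1) * (W + H + 1)) with d in Hn by (field; lra). nra. }
  destruct small as [n Hn].
  destruct (HXY n) as (x & y & [Hin Hbad] & Hx & Hy).
  assert (H2n : 0 < 2 ^ n) by (apply pow_lt; lra).
  assert (Hwn : 0 <= W / 2 ^ n) by (apply Rmult_le_pos; [lra|]; apply Rlt_le, Rinv_0_lt_compat; lra).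
  assert (Hhn : 0 <= H / 2 ^ n) by (apply Rmult_le_pos; [lra|]; apply Rlt_le, Rinv_0_lt_compat; lra).
  assert (Hs : (W + H) / 2 ^ n = W / 2 ^ n + H / 2 ^ n) by (field; lra).
  assert (Hsmall : Rabs (circulation p q x y (W / 2 ^ n) (H / 2 ^ n))
            <= 4 * eps * (W / 2 ^ n + H / 2 ^ n) ^ 2).
  { apply Hloc; (assumption || lra). }
  rewrite <- Hs in Hsmall.
  assert (H4 : 4 ^ n = 2 ^ n * 2 ^ n) by (rewrite <- Rpow_mult_distr; f_equal; lra).
  replace (4 * eps * ((W + H) / 2 ^ n) ^ 2) with (c / 4 ^ n * ((W + H) ^ 2 / (2 * ((W + H) ^ 2 + 1)))) in Hsmall.
  2:{ unfold eps. rewrite H4. field. split; lra. }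
  assert (0 < c / 4 ^ n) by (apply Rdiv_lt_0_compat; [|apply pow_lt]; lra).
  assert ((W + H) ^ 2 / (2 * ((W + H) ^ 2 + 1)) < 1).
  { apply (Rmult_lt_reg_r (2 * ((W + H) ^ 2 + 1))); [lra|].
    unfold Rdiv. rewrite Rmult_assoc, Rinv_l; lra. }
  nra.
Qed.
End Goursat.

End RealForms.

(** * Complex derivatives and the exponential *)

(** The target carries the topology of the modulus, for which the product and
    chain rules hold; the product topology of R x R is reached through
    [ex_Cderiv_of_ex_derive]. *)
Definition is_Cderiv (f : C -> C) (z l : C) : Prop :=
  is_derive (K := C_AbsRing) (V := AbsRing_NormedModule C_AbsRing) f z l.
Definition ex_Cderiv (f : C -> C) (z : C) : Prop := exists l, is_Cderiv f z l.

Lemma is_Cderiv_eps (f : C -> C) (z l : C) :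
  is_Cderiv f z l <->
  (forall eps, 0 < eps -> exists delta, 0 < delta /\ forall w, Cmod (w - z) < delta ->
     Cmod (f w - f z - l * (w - z)) <= eps * Cmod (w - z))%R.
Proof.
split.
- intros [_ Hd] eps Heps.
  destruct (Hd z (fun P HP => HP) (mkposreal eps Heps)) as [d Hd'].
  exists d. split; [apply cond_pos|]. intros w Hw.
  generalize (Hd' w Hw). rewrite (Cmult_comm l). exact (fun h => h).
- intros Hd. split; [apply is_linear_scal_l|].
  intros x Hx eps.
  assert (Hxz : z = x).
  { apply (is_filter_lim_locally_unique (V := AbsRing_NormedModule C_AbsRing)). exact Hx. }
  subst x.
  destruct (Hd eps (cond_pos eps)) as (d & Hd0 & Hd').
  exists (mkposreal d Hd0). intros w Hw.
  generalize (Hd' w Hw). rewrite (Cmult_comm l). exact (fun h => h).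
Qed.

Lemma ex_Cderiv_of_ex_derive (f : C -> C) (z : C) :
  ex_derive (K := C_AbsRing) (V := C_NormedModule) f z -> ex_Cderiv f z.
Proof.
intros [l [_ Hd]]. exists l. apply is_Cderiv_eps. intros eps Heps.
destruct (Hd z (fun P HP => HP) (mkposreal eps Heps)) as [d Hd'].
exists d. split; [apply cond_pos|]. intros w Hw.
generalize (Hd' w Hw). rewrite (Cmult_comm l). exact (fun h => h).
Qed.

Lemma is_Cderiv_const c z : is_Cderiv (fun _ => c) z 0.
Proof. exact (is_derive_const (K := C_AbsRing) (V := AbsRing_NormedModule C_AbsRing) c z). Qed.

Lemma is_Cderiv_id z : is_Cderiv (fun w => w) z 1.
Proof. exact (is_derive_id (K := C_AbsRing) z). Qed.

Lemma is_Cderiv_plus f g z lf lg : is_Cderiv f z lf -> is_Cderiv g z lg ->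
  is_Cderiv (fun w => f w + g w) z (lf + lg).
Proof.
  exact (is_derive_plus (K := C_AbsRing) (V := AbsRing_NormedModule C_AbsRing) f g z lf lg). Qed.

Lemma is_Cderiv_minus f g z lf lg : is_Cderiv f z lf -> is_Cderiv g z lg ->
  is_Cderiv (fun w => f w - g w) z (lf - lg).
Proof.
  exact (is_derive_minus (K := C_AbsRing) (V := AbsRing_NormedModule C_AbsRing) f g z lf lg). Qed.

Lemma is_Cderiv_mult f g z lf lg : is_Cderiv f z lf -> is_Cderiv g z lg ->
  is_Cderiv (fun w => f w * g w) z (lf * g z + f z * lg).
Proof.
intros Hf Hg. exact (is_derive_mult (K := C_AbsRing) f g z lf lg Hf Hg Cmult_comm).
Qed.

Lemma is_Cderiv_comp f g z lf lg : is_Cderiv f (g z) lf -> is_Cderiv g z lg ->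
  is_Cderiv (fun w => f (g w)) z (lg * lf).
Proof.
  exact (is_derive_comp (K := C_AbsRing) (V := AbsRing_NormedModule C_AbsRing) f g z lf lg). Qed.

Lemma is_Cderiv_ext f g z l : (forall w, f w = g w) -> is_Cderiv f z l -> is_Cderiv g z l.
Proof. exact (is_derive_ext (K := C_AbsRing) (V := AbsRing_NormedModule C_AbsRing) f g z l). Qed.

Lemma ex_Cderiv_const c z : ex_Cderiv (fun _ => c) z.
Proof. eexists. apply is_Cderiv_const. Qed.

Lemma ex_Cderiv_id z : ex_Cderiv (fun w => w) z.
Proof. eexists. apply is_Cderiv_id. Qed.

Lemma ex_Cderiv_plus f g z : ex_Cderiv f z -> ex_Cderiv g z ->
  ex_Cderiv (fun w => f w + g w) z.
Proof. intros [lf Hf] [lg Hg]. eexists. exact (is_Cderiv_plus _ _ _ _ _ Hf Hg). Qed.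

Lemma ex_Cderiv_minus f g z : ex_Cderiv f z -> ex_Cderiv g z ->
  ex_Cderiv (fun w => f w - g w) z.
Proof. intros [lf Hf] [lg Hg]. eexists. exact (is_Cderiv_minus _ _ _ _ _ Hf Hg). Qed.

Lemma ex_Cderiv_mult f g z : ex_Cderiv f z -> ex_Cderiv g z ->
  ex_Cderiv (fun w => f w * g w) z.
Proof. intros [lf Hf] [lg Hg]. eexists. exact (is_Cderiv_mult _ _ _ _ _ Hf Hg). Qed.

Lemma ex_Cderiv_comp f g z : ex_Cderiv f (g z) -> ex_Cderiv g z ->
  ex_Cderiv (fun w => f (g w)) z.
Proof. intros [lf Hf] [lg Hg]. eexists. exact (is_Cderiv_comp _ _ _ _ _ Hf Hg). Qed.

Lemma Cderiv_continuous f z : ex_Cderiv f z ->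
  forall eps, (0 < eps)%R -> exists delta, (0 < delta)%R /\
    forall w, (Cmod (w - z) < delta -> Cmod (f w - f z) < eps)%R.
Proof.
intros [l Hl] eps Heps.
destruct (proj1 (is_Cderiv_eps f z l) Hl 1%R Rlt_0_1) as (d & Hd & Hfd).
assert (Hl0 := Cmod_ge_0 l).
exists (Rmin d (eps / (Cmod l + 2))). split.
- apply Rmin_pos; [assumption|]. apply Rdiv_lt_0_compat; lra.
- intros w Hw.
  assert (Hw1 := Rlt_le_trans _ _ _ Hw (Rmin_l _ _)).
  assert (Hw2 := Rlt_le_trans _ _ _ Hw (Rmin_r _ _)).
  generalize (Hfd w Hw1); intros Hb.
  replace (f w - f z) with ((f w - f z - l * (w - z)) + l * (w - z)) by ring.
  eapply Rle_lt_trans; [apply Cmod_triangle|]. rewrite Cmod_mult.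
  assert (Hw0 := Cmod_ge_0 (w - z)).
  apply (Rmult_lt_compat_r (Cmod l + 2)) in Hw2; [|lra].
  replace (eps / (Cmod l + 2) * (Cmod l + 2))%R with eps in Hw2 by (field; lra).
  nra.
Qed.

Lemma Cexp_plus z w : Cexp (z + w) = Cexp z * Cexp w.
Proof.
destruct z as [a b], w as [c d]. unfold Cexp, Cmult, Cplus, Re, Im; simpl.
rewrite exp_plus, cos_plus, sin_plus. f_equal; ring.
Qed.

Lemma Cmod_Cexp z : Cmod (Cexp z) = exp (Re z).
Proof.
unfold Cmod, Cexp; simpl fst; simpl snd.
replace ((exp (Re z) * cos (Im z)) ^ 2 + (exp (Re z) * sin (Im z)) ^ 2)%R
  with (exp (Re z) ^ 2)%R.
- rewrite <- Rsqr_pow2. apply sqrt_Rsqr, Rlt_le, exp_pos.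
- generalize (sin2_cos2 (Im z)). unfold Rsqr. intros H.
  transitivity (exp (Re z) ^ 2 * (sin (Im z) * sin (Im z) + cos (Im z) * cos (Im z)))%R;
    [rewrite H|]; ring.
Qed.

Lemma Cexp_0 : Cexp 0 = 1.
Proof. unfold Cexp; simpl. rewrite exp_0, cos_0, sin_0. apply injective_projections; simpl; ring. Qed.

Lemma Cexp_neq_0 z : Cexp z <> 0.
Proof. apply Cmod_gt_0. rewrite Cmod_Cexp. apply exp_pos. Qed.

Lemma Cmod_le_Re_Im z : (Cmod z <= Rabs (Re z) + Rabs (Im z))%R.
Proof.
unfold Cmod.
replace (fst z ^ 2 + snd z ^ 2)%R with (Rabs (Re z) ^ 2 + Rabs (Im z) ^ 2)%R
  by (now rewrite !pow2_abs).
generalize (Rabs_pos (Re z)), (Rabs_pos (Im z)). intros H1 H2.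
rewrite <- (sqrt_Rsqr (Rabs (Re z) + Rabs (Im z))) by lra.
apply sqrt_le_1_alt. unfold Rsqr. nra.
Qed.

Lemma im_le_Cmod z : (Rabs (Im z) <= Cmod z)%R.
Proof. eapply Rle_trans; [|apply Rmax_Cmod]. apply Rmax_r. Qed.

(** By the addition formula it is enough to know Cexp h = 1 + h + o(h), which
    comes from the derivatives of exp, cos and sin at 0. *)
Lemma is_Cderiv_Cexp z : is_Cderiv Cexp z (Cexp z).
Proof.
apply is_Cderiv_eps. intros eps Heps.
assert (D : forall f l, is_derive f 0%R l -> forall e, (0 < e)%R ->
   exists d, (0 < d)%R /\ forall h, (Rabs h < d -> Rabs (f h - f 0 - l * h) <= e * Rabs h)%R).
{ intros f l Hf e He. destruct Hf as [_ Hf].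
  destruct (Hf 0%R (fun P HP => HP) (mkposreal e He)) as [d Hd].
  exists d. split; [apply cond_pos|]. intros h Hh.
  assert (B : ball (M := R_UniformSpace) 0%R d h).
  { unfold ball; simpl. unfold AbsRing_ball, abs, minus, plus, opp; simpl.
    now rewrite Ropp_0, Rplus_0_r. }
  generalize (Hd h B). unfold norm, minus, plus, opp, scal; simpl.
  unfold abs, mult, plus, opp; simpl. rewrite !Ropp_0, !Rplus_0_r.
  replace (f h + - f 0 + - (h * l))%R with (f h - f 0 - l * h)%R by ring. auto. }
set (e := Rmin 1 (eps / (8 * (1 + exp (Re z))))%R).
assert (He0 := exp_pos (Re z)).
assert (He : (0 < e)%R) by (apply Rmin_pos; [lra | apply Rdiv_lt_0_compat; lra]).
destruct (D exp 1%R ltac:(auto_derive; [trivial | rewrite exp_0; ring]) e He) as (d1 & Hd1 & H1).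
destruct (D cos 0%R ltac:(auto_derive; [trivial | rewrite sin_0; ring]) e He) as (d2 & Hd2 & H2).
destruct (D sin 1%R ltac:(auto_derive; [trivial | rewrite cos_0; ring]) e He) as (d3 & Hd3 & H3).
set (d := Rmin (Rmin d1 (Rmin d2 d3)) (Rmin e (1 / 2))).
exists d. split.
{ unfold d. apply Rmin_pos; apply Rmin_pos; [| apply Rmin_pos | |]; lra. }
intros w Hw. set (h := w - z).
replace (Cexp w - Cexp z - Cexp z * h) with (Cexp z * (Cexp h - 1 - h)).
2:{ replace w with (z + h) by (unfold h; ring). rewrite Cexp_plus. ring. }
fold h in Hw.
assert (Hd' : (d <= d1 /\ d <= d2 /\ d <= d3 /\ d <= e /\ d <= 1 / 2)%R).
{ unfold d.
  generalize (Rmin_l (Rmin d1 (Rmin d2 d3)) (Rmin e (1 / 2))),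
    (Rmin_r (Rmin d1 (Rmin d2 d3)) (Rmin e (1 / 2))),
    (Rmin_l d1 (Rmin d2 d3)), (Rmin_r d1 (Rmin d2 d3)),
    (Rmin_l d2 d3), (Rmin_r d2 d3), (Rmin_l e (1 / 2)), (Rmin_r e (1 / 2)). lra. }
rewrite Cmod_mult, Cmod_Cexp.
assert (Hm0 := Cmod_ge_0 h).
destruct h as [x y] eqn:Eh. rewrite <- Eh in *.
assert (Hx : (Rabs x <= Cmod h)%R) by (rewrite Eh; apply (re_le_Cmod (x, y))).
assert (Hy : (Rabs y <= Cmod h)%R) by (rewrite Eh; apply (im_le_Cmod (x, y))).
destruct Hd' as (? & ? & ? & ? & ?).
assert (Hxd : (Rabs x < d)%R) by (eapply Rle_lt_trans; eassumption).
assert (Hyd : (Rabs y < d)%R) by (eapply Rle_lt_trans; eassumption).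
generalize (H1 x ltac:(lra)), (H2 y ltac:(lra)), (H3 y ltac:(lra)).
rewrite exp_0, cos_0, sin_0. intros B1 B2 B3.
assert (Hxm : (Rabs (exp x - 1 - 1 * x) <= e * Cmod h)%R)
  by (eapply Rle_trans; [exact B1|]; apply Rmult_le_compat_l; lra).
assert (Hcm : (Rabs (cos y - 1 - 0 * y) <= e * Cmod h)%R)
  by (eapply Rle_trans; [exact B2|]; apply Rmult_le_compat_l; lra).
assert (Hsm : (Rabs (sin y - 0 - 1 * y) <= e * Cmod h)%R)
  by (eapply Rle_trans; [exact B3|]; apply Rmult_le_compat_l; lra).
clear B1 B2 B3.
assert (He1 : (e <= 1)%R) by apply Rmin_l.
assert (HRe : (Rabs (exp x * cos y - 1 - x) <= 3 * e * Cmod h)%R).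
{ replace (exp x * cos y - 1 - x)%R
    with ((exp x - 1 - 1 * x) * cos y + (1 + x) * (cos y - 1 - 0 * y))%R by ring.
  eapply Rle_trans; [apply Rabs_triang|]. rewrite !Rabs_mult.
  assert (Rabs (cos y) <= 1)%R by (apply Rabs_le_between; generalize (COS_bound y); lra).
  assert (Rabs (1 + x) <= 2)%R.
  { assert (Hx2 : (Rabs x < 1 / 2)%R) by lra. apply Rabs_lt_between in Hx2. apply Rabs_le_between; lra. }
  generalize (Rabs_pos (cos y)), (Rabs_pos (1 + x)),
    (Rabs_pos (exp x - 1 - 1 * x)), (Rabs_pos (cos y - 1 - 0 * y)). nra. }
assert (HIm : (Rabs (exp x * sin y - 0 - y) <= 5 * e * Cmod h)%R).
{ replace (exp x * sin y - 0 - y)%R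
    with (exp x * (sin y - 0 - 1 * y) + (exp x - 1 - 1 * x + x) * y)%R by ring.
  eapply Rle_trans; [apply Rabs_triang|]. rewrite !Rabs_mult.
  assert (Hx2 : (Rabs x < 1 / 2)%R) by lra.
  assert (Hxp : (Rabs (exp x - 1 - 1 * x) <= 1 / 2)%R) by nra.
  assert (E1 : (Rabs (exp x) <= 2)%R).
  { apply Rabs_lt_between in Hx2. apply Rabs_le_between in Hxp. apply Rabs_le_between. lra. }
  assert (E2 : (Rabs (exp x - 1 - 1 * x + x) <= 2 * e)%R).
  { eapply Rle_trans; [apply Rabs_triang|]. nra. }
  generalize (Rabs_pos (exp x)), (Rabs_pos (sin y - 0 - 1 * y)), (Rabs_pos y),
     (Rabs_pos (exp x - 1 - 1 * x + x)). intros.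
  assert (Rabs (exp x) * Rabs (sin y - 0 - 1 * y) <= 2 * (e * Cmod h))%R
    by (apply Rmult_le_compat; assumption).
  assert (Rabs (exp x - 1 - 1 * x + x) * Rabs y <= 2 * e * Cmod h)%R
    by (apply Rmult_le_compat; assumption).
  nra. }
assert (HM : (Cmod (Cexp h - 1 - h) <= 8 * e * Cmod h)%R).
{ eapply Rle_trans; [apply Cmod_le_Re_Im|].
  replace (Re (Cexp h - 1 - h)) with (exp x * cos y - 1 - x)%R by (rewrite Eh; reflexivity).
  replace (Im (Cexp h - 1 - h)) with (exp x * sin y - 0 - y)%R
    by (rewrite Eh; unfold Cexp, Cminus, Cplus, Copp, Im, Re; simpl; ring).
  lra. }
assert (He2 : (e * (8 * (1 + exp (Re z))) <= eps)%R).
{ eapply Rle_trans; [apply Rmult_le_compat_r; [lra | apply Rmin_r]|].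
  right. field. lra. }
assert (exp (Re z) * Cmod (Cexp h - 1 - h) <= exp (Re z) * (8 * e * Cmod h))%R
  by (apply Rmult_le_compat_l; lra).
assert (e * (8 * (1 + exp (Re z))) * Cmod h <= eps * Cmod h)%R
  by (apply Rmult_le_compat_r; lra).
nra.
Qed.

(** The Cauchy-Riemann equations, in the form that makes Im f dx + Re f dy a
    closed form. *)
Lemma Cderiv_differentiable f x y l : is_Cderiv f (x, y) l ->
  differentiable_pt_lim (fun u v => Re (f (u, v))) x y (Re l) (- Im l) /\
  differentiable_pt_lim (fun u v => Im (f (u, v))) x y (Im l) (Re l).
Proof.
intros Hf.
assert (D : forall eps : posreal, locally_2d (fun u v =>
   (Cmod (f (u, v) - f (x, y) - l * ((u, v) - (x, y)))
     <= eps * Rmax (Rabs (u - x)) (Rabs (v - y)))%R) x y).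
{ intros eps.
  destruct (proj1 (is_Cderiv_eps f _ l) Hf (eps / 2)%R) as (d & Hd & H);
    [apply is_pos_div_2|].
  exists (mkposreal (d / 2)%R ltac:(lra)). intros u v Hu Hv. simpl in Hu, Hv.
  assert (Hm : (Cmod ((u, v) - (x, y)) <= Rabs (u - x) + Rabs (v - y))%R)
    by apply (Cmod_le_Re_Im ((u, v) - (x, y))).
  eapply Rle_trans; [apply H; lra|].
  generalize (Rmax_l (Rabs (u - x)) (Rabs (v - y))), (Rmax_r (Rabs (u - x)) (Rabs (v - y))),
    (cond_pos eps). intros. nra. }
split; intros eps; destruct (D eps) as [d Hd]; exists d; intros u v Hu Hv;
  (eapply Rle_trans; [|apply (Hd u v Hu Hv)]).
- eapply Rle_trans; [|apply re_le_Cmod]. right. f_equal.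
  unfold Cminus, Cplus, Copp, Cmult, Re, Im; simpl; ring.
- eapply Rle_trans; [|apply im_le_Cmod]. right. f_equal.
  unfold Cminus, Cplus, Copp, Cmult, Re, Im; simpl; ring.
Qed.

(** * The identity principle in a half-plane *)

Lemma ex_Cderiv_Cexp z : ex_Cderiv Cexp z.
Proof. exists (Cexp z). apply is_Cderiv_Cexp. Qed.

Lemma ex_Cderiv_polar g (w : C) (r : R) (z : C) :
  ex_Cderiv g (w + r * Cexp z) -> ex_Cderiv (fun z => g (w + r * Cexp z)) z.
Proof.
intros Hg. apply (ex_Cderiv_comp g (fun z => w + r * Cexp z)); [exact Hg|].
apply ex_Cderiv_plus; [apply ex_Cderiv_const|].
apply ex_Cderiv_mult; [apply ex_Cderiv_const | apply ex_Cderiv_Cexp].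
Qed.

Lemma Cmod_polar (w : C) (r x y : R) :
  (0 <= r)%R -> Cmod (w + r * Cexp (x, y) - w) = (r * exp x)%R.
Proof.
intros Hr. replace (w + r * Cexp (x, y) - w) with (r * Cexp (x, y)) by ring.
now rewrite Cmod_mult, Cmod_Cexp, Cmod_R, Rabs_pos_eq.
Qed.

(** In the coordinate t = x + i y with z = w + r e^t, the rectangle [-L, 0] x
    [0, 2 pi] covers an annulus, and its horizontal sides cancel by
    periodicity. Goursat's theorem then says that the mean of Re g over the
    circle of radius r equals the mean over the circle of radius r e^(-L),
    which is close to Re g(w) for large L. *)
Lemma Re_center_le_circle (g : C -> C) (w : C) (r B : R) :
  (0 < r)%R ->
  (forall z, (Cmod (z - w) <= r)%R -> ex_Cderiv g z) ->
  (forall t, (0 <= t <= 2 * PI)%R -> (Cmod (g (w + r * Cexp (0, t)%R)%C) <= B)%R) ->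
  (Re (g w) <= B)%R.
Proof.
intros Hr Hg HB. apply Rnot_lt_le. intros Hlt.
destruct (Cderiv_continuous g w) with (eps := ((Re (g w) - B) / 2)%R) as (d & Hd & Hgd).
{ apply Hg. replace (w - w) with (RtoC 0) by ring. rewrite Cmod_0. lra. }
{ lra. }
assert (HL : exists L, (0 <= L /\ r * exp (- L) < d)%R).
{ exists (r / d)%R.
  assert (0 < r / d)%R by (apply Rdiv_lt_0_compat; lra). split; [lra|].
  rewrite exp_Ropp. generalize (exp_ineq1 (r / d) ltac:(lra)). intros He.
  apply (Rmult_lt_reg_r (exp (r / d))); [apply exp_pos|].
  rewrite Rmult_assoc, Rinv_l by (apply Rgt_not_eq, exp_pos).
  apply (Rmult_lt_compat_l d) in He; [|lra].
  replace (d * (1 + r / d))%R with (d + r)%R in He by (field; lra). lra. }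
destruct HL as (L & HL0 & HL).
set (p x y := Im (g (w + r * Cexp (x, y)))).
set (q x y := Re (g (w + r * Cexp (x, y)))).
assert (closed : forall x y, (- L <= x <= - L + L)%R -> (0 <= y <= 0 + 2 * PI)%R ->
  exists lx k ly, differentiable_pt_lim p x y lx k /\ differentiable_pt_lim q x y k ly).
{ intros x y Hx Hy.
  destruct (ex_Cderiv_polar g w r (x, y)) as [l Hl].
  - apply Hg. rewrite Cmod_polar by lra.
    rewrite <- (Rmult_1_r r) at 2. apply Rmult_le_compat_l; [lra|].
    rewrite <- exp_0. destruct (Rle_lt_or_eq_dec x 0 ltac:(lra)) as [Hx0| ->];
      [left; now apply exp_increasing | lra].
  - exists (Im l), (Re l), (- Im l)%R.
    destruct (Cderiv_differentiable _ _ _ _ Hl) as [A1 A2]. now split. }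
assert (HPI := PI_RGT_0).
assert (G := goursat_circulation p q (- L) 0 L (2 * PI) HL0 ltac:(lra) closed).
assert (V := ex_RInt_vertical p q (- L) 0 L (2 * PI) closed 0 (2 * PI)).
unfold circulation in G.
assert (Hper : RInt (fun t => p t (0 + 2 * PI)%R) (- L) (- L + L)
             = RInt (fun t => p t 0%R) (- L) (- L + L)).
{ apply RInt_ext. intros t _. unfold p. do 4 f_equal. unfold Cexp; simpl.
  now rewrite Rplus_0_l, sin_2PI, cos_2PI, sin_0, cos_0. }
rewrite Hper in G. clear Hper.
assert (U : (RInt (fun t => q (- L + L)%R t) 0 (0 + 2 * PI) <= 2 * PI * B)%R).
{ replace (2 * PI * B)%R with (RInt (fun _ => B) 0 (0 + 2 * PI)).
  2:{ rewrite RInt_const. unfold scal; simpl. unfold mult; simpl. ring. }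
  apply RInt_le; [lra | apply V; lra | apply ex_RInt_const |].
  intros t Ht. unfold q. replace (- L + L)%R with 0%R by ring.
  eapply Rle_trans; [apply Rle_abs|]. eapply Rle_trans; [apply re_le_Cmod|].
  apply HB. lra. }
assert (D : (2 * PI * ((Re (g w) + B) / 2) <= RInt (fun t => q (- L)%R t) 0 (0 + 2 * PI))%R).
{ replace (2 * PI * ((Re (g w) + B) / 2))%R
    with (RInt (fun _ => ((Re (g w) + B) / 2)%R) 0 (0 + 2 * PI)).
  2:{ rewrite RInt_const. unfold scal; simpl. unfold mult; simpl. ring. }
  apply RInt_le; [lra | apply ex_RInt_const | apply V; lra |].
  intros t Ht. unfold q.
  assert (Hc := Hgd (w + r * Cexp (- L, t)%R)%C).
  rewrite Cmod_polar in Hc by lra. specialize (Hc HL).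
  generalize (re_le_Cmod (g (w + r * Cexp (- L, t)%R)%C - g w)). intros Hre.
  assert (Hre' := Rle_lt_trans _ _ _ Hre Hc). apply Rabs_lt_between in Hre'.
  replace (Re (g (w + r * Cexp (- L, t)%R)%C - g w))
    with (Re (g (w + r * Cexp (- L, t)%R)%C) - Re (g w))%R in Hre' by reflexivity.
  lra. }
set (I1 := RInt (fun t => q (- L + L)%R t) 0 (0 + 2 * PI)) in *.
set (I2 := RInt (fun t => q (- L)%R t) 0 (0 + 2 * PI)) in *.
set (I3 := RInt (fun t => p t 0%R) (- L) (- L + L)) in *.
nra.
Qed.

Lemma Cmod_center_le_circle (g : C -> C) (w : C) (r B : R) :
  (0 < r)%R ->
  (forall z, (Cmod (z - w) <= r)%R -> ex_Cderiv g z) ->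
  (forall t, (0 <= t <= 2 * PI)%R -> (Cmod (g (w + r * Cexp (0, t)%R)%C) <= B)%R) ->
  (Cmod (g w) <= B)%R.
Proof.
intros Hr Hg HB.
assert (Hm := Cmod_ge_0 (g w)).
(* A constant factor turns g(w) into the real number |g(w)|^2. *)
assert (H : (Re (Cconj (g w) * g w) <= Cmod (g w) * B)%R).
{ apply (Re_center_le_circle (fun z => Cconj (g w) * g z) w r); [assumption| |].
  - intros z Hz. apply ex_Cderiv_mult; [apply ex_Cderiv_const | now apply Hg].
  - intros t Ht. rewrite Cmod_mult, Cmod_conj. apply Rmult_le_compat_l; auto. }
rewrite Cmult_comm, <- Cmod2_conj in H. simpl in H.
destruct Hm as [Hm|Hm].
- apply (Rmult_le_reg_l (Cmod (g w))); lra.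
- rewrite <- Hm. eapply Rle_trans; [apply Cmod_ge_0 | apply (HB 0%R)].
  generalize PI_RGT_0; lra.
Qed.

Definition tends_to_0 (a : nat -> C) : Prop :=
  forall eps, (0 < eps)%R -> exists N0, forall N, (N0 <= N)%nat -> (Cmod (a N) <= eps)%R.

(** With eta = (z - w) / (r u), the factor exp (lam (eta + eta^2 / 2)) is 1 at
    w. On the circle its modulus is exp (lam (x + x^2 - 1/2)) with x = Re eta,
    and x + x^2 - 1/2 <= - 3/16 for -1 <= x <= 1/4. Hence a large lam makes
    the bounded family small where x <= 1/4, and then a large N makes it small
    on the remaining arc. *)
Lemma tends_to_0_center (F : nat -> C -> C) (w u : C) (r : R) :
  (0 < r)%R -> Cmod u = 1%R ->
  (forall N z, (Cmod (z - w) <= r)%R -> ex_Cderiv (F N) z) ->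
  (forall eps, (0 < eps)%R -> exists N0, forall N N' z, (N0 <= N)%nat -> (N0 <= N')%nat ->
     (Cmod (z - w) <= r)%R -> (Cmod (F N z - F N' z) <= eps)%R) ->
  (forall z, Cmod (z - w) = r -> (r / 4 <= Re ((z - w) * Cconj u))%R ->
     tends_to_0 (fun N => F N z)) ->
  tends_to_0 (fun N => F N w).
Proof.
intros Hr Hu Hd Hc Hz.
destruct (Hc 1%R Rlt_0_1) as [N1 HN1].
assert (HM : exists M, (0 <= M)%R /\ forall t, (0 <= t <= 2 * PI)%R ->
                 (Cmod (F N1 (w + r * Cexp (0, t)%R)%C) <= M)%R).
{ destruct (continuity_ab_maj (fun t => Cmod (F N1 (w + r * Cexp (0, t)%R)%C)) 0 (2 * PI))
    as (m & Hm & _).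
  - generalize PI_RGT_0; lra.
  - intros t _ eps Heps.
    destruct (Cderiv_continuous (fun z => F N1 (w + r * Cexp z)) (0, t)%R) with (eps := eps)
      as (d & Hd0 & Hcont); [|assumption|].
    { apply ex_Cderiv_polar, Hd. rewrite Cmod_polar, exp_0; lra. }
    exists d. split; [assumption|]. intros t' [_ Ht']. simpl in *. unfold Rdist in *.
    assert (Hs : (Cmod ((0, t')%R - (0, t)%R) < d)%R).
    { replace ((0, t')%R - (0, t)%R) with (Ci * (t' - t)%R)
        by (apply injective_projections; simpl; ring).
      rewrite Cmod_mult, Cmod_Ci, Cmod_R. lra. }
    specialize (Hcont _ Hs).
    eapply Rle_lt_trans; [|exact Hcont].
    apply Rabs_le_between.
    set (A := F N1 (w + r * Cexp (0, t')%R)%C). set (B := F N1 (w + r * Cexp (0, t)%R)%C).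
    generalize (Cmod_triangle (A - B) B), (Cmod_triangle (B - A) A).
    replace (A - B + B) with A by ring. replace (B - A + A) with B by ring.
    replace (Cmod (B - A)) with (Cmod (A - B))
      by (rewrite <- Cmod_opp; f_equal; ring). lra.
  - exists (Cmod (F N1 (w + r * Cexp (0, m)%R)%C)). split; [apply Cmod_ge_0|exact Hm]. }
destruct HM as (M & HM0 & HM).
intros eps Heps.
(* Chosen so that 3 lam / 16 = (M + 1) / eps, hence (M + 1) exp (- 3 lam / 16)
   <= eps. *)
set (lam := (16 / 3 * ((M + 1) / eps))%R).
assert (Hlam : (0 < (M + 1) / eps)%R) by (apply Rdiv_lt_0_compat; lra).
assert (Hsmall : ((M + 1) * exp (- (3 / 16) * lam) <= eps)%R).
{ replace (- (3 / 16) * lam)%R with (- ((M + 1) / eps))%R by (unfold lam; field; lra).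
  rewrite exp_Ropp. apply (Rmult_le_reg_r (exp ((M + 1) / eps))); [apply exp_pos|].
  rewrite Rmult_assoc, Rinv_l by (apply Rgt_not_eq, exp_pos).
  generalize (exp_ineq1 ((M + 1) / eps) ltac:(lra)). intros He.
  apply (Rmult_lt_compat_l eps) in He; [|lra].
  replace (eps * (1 + (M + 1) / eps))%R with (eps + (M + 1))%R in He by (field; lra). lra. }
set (e1 := (eps * exp (- (3 / 2) * lam))%R).
assert (He1 : (0 < e1)%R) by (apply Rmult_lt_0_compat; [lra | apply exp_pos]).
destruct (Hc (e1 / 2)%R ltac:(lra)) as [N2 HN2].
exists (max N1 N2). intros N HN.
set (eta z := (z - w) * (Cconj u * RtoC (/ r))).
set (phi z := Cexp (lam * (eta z + eta z * eta z * RtoC (1 / 2)))).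
assert (Hphiw : F N w * phi w = F N w).
{ unfold phi, eta. replace (w - w) with (RtoC 0) by ring.
  rewrite !Cmult_0_l, Cplus_0_l, Cmult_0_r, Cexp_0. ring. }
rewrite <- Hphiw.
apply (Cmod_center_le_circle (fun z => F N z * phi z) w r); [assumption| |].
- intros z Hzr. apply ex_Cderiv_mult; [now apply Hd|].
  assert (ex_Cderiv eta z).
  { apply ex_Cderiv_mult; [|apply ex_Cderiv_const].
    apply ex_Cderiv_minus; [apply ex_Cderiv_id | apply ex_Cderiv_const]. }
  apply (ex_Cderiv_comp Cexp); [apply ex_Cderiv_Cexp|].
  apply ex_Cderiv_mult; [apply ex_Cderiv_const|].
  apply ex_Cderiv_plus; [assumption|].
  apply ex_Cderiv_mult; [|apply ex_Cderiv_const]. now apply ex_Cderiv_mult.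
- intros t Ht. set (z := w + r * Cexp (0, t)%R).
  assert (Hzr : Cmod (z - w) = r) by (unfold z; rewrite Cmod_polar, exp_0; lra).
  assert (Hmeta : Cmod (eta z) = 1%R).
  { unfold eta. rewrite !Cmod_mult, Cmod_conj, Hu, Hzr, Cmod_R, Rabs_pos_eq.
    - field. lra.
    - apply Rlt_le, Rinv_0_lt_compat, Hr. }
  assert (Hsq : (Re (eta z) ^ 2 + Im (eta z) ^ 2 = 1)%R)
    by (rewrite <- Cmod2_alt, Hmeta; ring).
  assert (Hphi : Cmod (phi z) = exp (lam * (Re (eta z) + Re (eta z) ^ 2 - 1 / 2))).
  { unfold phi. rewrite Cmod_Cexp. f_equal.
    transitivity (lam * (Re (eta z) + (Re (eta z) ^ 2 - Im (eta z) ^ 2) / 2))%R.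
    - destruct (eta z) as [a b]. unfold Cmult, Cplus, Re, Im; simpl. field.
    - f_equal. lra. }
  assert (Heta : Re (eta z) = (Re ((z - w) * Cconj u) * / r)%R).
  { unfold eta. rewrite Cmult_assoc.
    destruct ((z - w) * Cconj u) as [a b]. simpl. ring. }
  assert (HFz := Cmod_ge_0 (F N z)).
  assert (Hexp : forall a b, (a <= b)%R -> (exp (lam * a) <= exp (lam * b))%R).
  { intros a b Hab. assert (lam * a <= lam * b)%R
      by (apply Rmult_le_compat_l; [unfold lam|]; lra).
    destruct H as [H|H]; [left; now apply exp_increasing | right; now rewrite H]. }
  rewrite Cmod_mult, Hphi.
  set (x := Re (eta z)) in *. set (y := Im (eta z)) in *.
  assert (Hx1 : (-1 <= x <= 1)%R) by nra.
  destruct (Rle_lt_dec (1 / 4) x) as [Hx|Hx].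
  + assert (Hzero : tends_to_0 (fun N => F N z)).
    { apply Hz; [assumption|]. rewrite Heta in Hx.
      apply (Rmult_le_compat_r r) in Hx; [|lra].
      rewrite Rmult_assoc, Rinv_l in Hx by lra. lra. }
    destruct (Hzero (e1 / 2)%R ltac:(lra)) as [N3 HN3].
    assert (HFN : (Cmod (F N z) <= e1)%R).
    { replace (F N z) with (F N z - F (max N2 N3) z + F (max N2 N3) z) by ring.
      eapply Rle_trans; [apply Cmod_triangle|].
      generalize (HN2 N (max N2 N3) z ltac:(lia) ltac:(lia) ltac:(lra)),
        (HN3 (max N2 N3) ltac:(lia)). lra. }
    apply Rle_trans with (e1 * exp (lam * (3 / 2)))%R.
    * apply Rmult_le_compat; [assumption | apply Rlt_le, exp_pos | assumption |].
      apply Hexp. nra.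
    * unfold e1. rewrite Rmult_assoc, <- exp_plus.
      replace (- (3 / 2) * lam + lam * (3 / 2))%R with 0%R by ring. rewrite exp_0. lra.
  + assert (HFN : (Cmod (F N z) <= M + 1)%R).
    { replace (F N z) with (F N z - F N1 z + F N1 z) by ring.
      eapply Rle_trans; [apply Cmod_triangle|].
      generalize (HN1 N N1 z ltac:(lia) ltac:(lia) ltac:(lra)), (HM t Ht). fold z. lra. }
    apply Rle_trans with ((M + 1) * exp (lam * (- (3 / 16))))%R.
    * apply Rmult_le_compat; [assumption | apply Rlt_le, exp_pos | assumption |].
      apply Hexp. nra.
    * rewrite (Rmult_comm lam). exact Hsmall.
Qed.

(** By induction on n the limit is 0 on the wedge Re z + (n/8) |Im z| >= a.
    For w in the next wedge the circle of radius |Im w| / 2 around w stays in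
    the half-plane, and its part at height at least r/4 above w, in the
    direction orthogonal to the side of the wedge, lies in the current wedge.
    The sign sg selects the upper or the lower half-plane. *)
Lemma tends_to_0_half_plane (F : nat -> C -> C) (a sg : R) :
  (sg = 1 \/ sg = -1)%R ->
  (forall N z, (0 < sg * Im z)%R -> ex_Cderiv (F N) z) ->
  (forall A eps, (0 < eps)%R -> exists N0, forall N N' z, (N0 <= N)%nat -> (N0 <= N')%nat ->
     (Cmod z <= A)%R -> (Cmod (F N z - F N' z) <= eps)%R) ->
  (forall z, (a <= Re z)%R -> tends_to_0 (fun N => F N z)) ->
  forall z, (0 < sg * Im z)%R -> tends_to_0 (fun N => F N z).
Proof.
intros Hsg Hd Hc Hz.
assert (W : forall n z, (0 < sg * Im z)%R -> (a <= Re z + INR n / 8 * (sg * Im z))%R ->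
   tends_to_0 (fun N => F N z)).
{ induction n as [|n IH]; intros w Hw Haw.
  - apply Hz. simpl in Haw. lra.
  - set (t := (INR n / 8)%R). set (s := sqrt (1 + t ^ 2)).
    assert (Ht : (0 <= t)%R) by (unfold t; generalize (pos_INR n); lra).
    assert (Hs2 : (s ^ 2 = 1 + t ^ 2)%R).
    { unfold s. rewrite <- Rsqr_pow2. apply Rsqr_sqrt. nra. }
    assert (Hs : (1 <= s)%R).
    { unfold s. rewrite <- sqrt_1 at 1. apply sqrt_le_1_alt. nra. }
    assert (Hsg2 : (sg ^ 2 = 1)%R) by (destruct Hsg as [-> | ->]; ring).
    set (r := (sg * Im w / 2)%R).
    (* The unit normal to the line Re z + t sg Im z = a. *)
    apply (tends_to_0_center F w (/ s, sg * t / s)%R r); unfold r in *.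
    + lra.
    + unfold Cmod; simpl fst; simpl snd.
      replace ((/ s) ^ 2 + (sg * t / s) ^ 2)%R with ((1 + sg ^ 2 * t ^ 2) / s ^ 2)%R by (field; lra).
      rewrite Hsg2, Hs2. replace ((1 + 1 * t ^ 2) / (1 + t ^ 2))%R with 1%R by (field; nra).
      apply sqrt_1.
    + intros N z Hzw. apply Hd.
      assert (Hi := Rle_trans _ _ _ (im_le_Cmod (z - w)) Hzw).
      apply Rabs_le_between in Hi. unfold Cminus, Cplus, Copp in Hi; simpl in Hi.
      unfold Im in *. destruct Hsg as [-> | ->]; lra.
    + intros eps Heps.
      destruct (Hc (Cmod w + sg * Im w / 2)%R eps Heps) as [N0 HN0].
      exists N0. intros N N' z HN HN' Hzw. apply HN0; try assumption.
      replace z with (w + (z - w)) by ring.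
      eapply Rle_trans; [apply Cmod_triangle|]. lra.
    + intros z Hzr Hzu.
      assert (Hi : (Rabs (Im (z - w)) <= sg * Im w / 2)%R) by (rewrite <- Hzr; apply im_le_Cmod).
      apply Rabs_le_between in Hi.
      unfold Cminus, Cplus, Copp in Hi; simpl in Hi.
      replace (Re ((z - w) * Cconj (/ s, (sg * t / s))%R))
        with ((Re z - Re w + t * (sg * (Im z - Im w))) / s)%R in Hzu
        by (unfold Cconj, Cmult, Cminus, Cplus, Copp, Re, Im; simpl; field; lra).
      assert (Hk : (sg * Im w / 8 <= Re z - Re w + t * (sg * (Im z - Im w)))%R).
      { apply (Rmult_le_compat_r s) in Hzu; [|lra].
        unfold Rdiv at 3 in Hzu. rewrite Rmult_assoc, Rinv_l in Hzu by lra. nra. }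
      apply IH.
      * unfold Im in *. destruct Hsg as [-> | ->]; lra.
      * fold t. rewrite S_INR in Haw. unfold t in *. nra. }
intros z Hzi.
destruct (INR_unbounded (8 * (a - Re z) / (sg * Im z))) as [n Hn].
apply (W n z Hzi).
set (k := (sg * Im z)%R) in *.
apply (Rmult_gt_compat_r k) in Hn; [|lra].
replace (8 * (a - Re z) / k * k)%R with (8 * (a - Re z))%R in Hn by (field; lra).
lra.
Qed.

(** * Series of complex numbers *)

Notation Csum := (sum_n (G := C_AbelianMonoid)).
Notation is_Cseries := (is_series (K := C_AbsRing) (V := C_NormedModule)).

Lemma Csum_0 (a : nat -> C) : Csum a 0 = a O.
Proof. exact (sum_O (G := C_AbelianMonoid) a). Qed.

Lemma Csum_S (a : nat -> C) n : Csum a (S n) = Csum a n + a (S n).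
Proof. exact (sum_Sn (G := C_AbelianMonoid) a n). Qed.

Lemma is_Cseries_tends (a : nat -> C) (l : C) :
  is_Cseries a l <-> tends_to_0 (fun N => Csum a N - l).
Proof.
unfold is_series.
split.
- intros H eps Heps.
  assert (H' := proj1 (filterlim_locally_ball_norm
    (K := C_AbsRing) (U := C_NormedModule) _ _) H (mkposreal eps Heps)).
  destruct H' as [N0 HN]. exists N0. intros N HN0. apply Rlt_le. exact (HN N HN0).
- intros H. apply (filterlim_locally_ball_norm (K := C_AbsRing) (U := C_NormedModule)).
  intros eps. destruct (H (eps / 2)%R (is_pos_div_2 eps)) as [N0 HN].
  exists N0. intros N HN0.
  apply (Rle_lt_trans _ (eps / 2)%R); [exact (HN N HN0)|].
  generalize (cond_pos eps); lra.
Qed.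

Lemma Cmod_Csum_le (a : nat -> C) (b : nat -> R) n :
  (forall k, (Cmod (a k) <= b k)%R) -> (Cmod (Csum a n) <= sum_n b n)%R.
Proof.
intros H. induction n as [|n IH].
- rewrite Csum_0, sum_O. apply H.
- rewrite Csum_S, sum_Sn. eapply Rle_trans; [apply Cmod_triangle|].
  apply Rplus_le_compat; [exact IH | apply H].
Qed.

Lemma Cmod_Cseries_le (a : nat -> C) (b : nat -> R) (l : C) (B : R) :
  is_Cseries a l -> (forall k, (Cmod (a k) <= b k)%R) -> (forall n, (sum_n b n <= B)%R) ->
  (Cmod l <= B)%R.
Proof.
intros Hl Hab HB. apply Rnot_lt_le. intros Hlt.
destruct (proj1 (is_Cseries_tends a l) Hl ((Cmod l - B) / 2)%R ltac:(lra)) as [N HN].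
specialize (HN N (Nat.le_refl N)).
assert (H := Rle_trans _ _ _ (Cmod_Csum_le a b N Hab) (HB N)).
assert (Ht := Cmod_triangle (Csum a N) (- (Csum a N - l))).
rewrite Cmod_opp in Ht. replace (Csum a N + - (Csum a N - l)) with l in Ht by ring. lra.
Qed.

(** Telescoping: the partial sums are at most 2 - 1/(n+1). *)
Lemma sum_inv_squares_le n : (sum_n (fun k => / INR (S k) ^ 2) n <= 2)%R.
Proof.
assert (H : (sum_n (fun k => / INR (S k) ^ 2) n <= 2 - / INR (S n))%R).
{ induction n as [|n IH].
  - rewrite sum_O. simpl. lra.
  - rewrite sum_Sn. unfold plus; simpl plus. eapply Rle_trans.
    + apply Rplus_le_compat_r. exact IH.
    + rewrite (S_INR (S n)). assert (Hn := pos_INR n). rewrite S_INR.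
      set (x := INR n) in *.
      apply (Rmult_le_reg_r ((x + 1) * (x + 1 + 1) ^ 2)); [nra|].
      field_simplify; [nra | lra | lra]. }
assert (0 < / INR (S n))%R by (apply Rinv_0_lt_compat, lt_0_INR; lia). lra.
Qed.

(** * Complex powers of positive reals *)

Lemma Rcpow_plus x z w : Rcpow x (z + w) = Rcpow x z * Rcpow x w.
Proof. unfold Rcpow. rewrite <- Cexp_plus. f_equal. ring. Qed.

Lemma Rcpow_mult_base x y z : (0 < x)%R -> (0 < y)%R ->
  Rcpow (x * y) z = Rcpow x z * Rcpow y z.
Proof.
intros Hx Hy. unfold Rcpow. rewrite <- Cexp_plus, ln_mult, RtoC_plus by assumption.
f_equal. ring.
Qed.

Lemma Rcpow_opp x z : Rcpow x z * Rcpow x (- z) = 1.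
Proof.
rewrite <- Rcpow_plus. unfold Rcpow. replace ((z + - z) * ln x) with (RtoC 0) by ring.
apply Cexp_0.
Qed.

Lemma Rcpow_nat x n : (0 < x)%R -> Rcpow x (INR n) = RtoC x ^ n.
Proof.
intros Hx. induction n as [|n IH].
- unfold Rcpow. simpl. rewrite Cmult_0_l. apply Cexp_0.
- rewrite S_INR, RtoC_plus, Rcpow_plus, IH, Cpow_S, Cmult_comm. f_equal.
  unfold Rcpow. rewrite Cmult_1_l. unfold Cexp; simpl.
  rewrite sin_0, cos_0, exp_ln by assumption. apply injective_projections; simpl; ring.
Qed.

Lemma Rcpow_opp_nat x n : (0 < x)%R -> Rcpow x (- INR n) = (/ RtoC x) ^ n.
Proof.
intros Hx. assert (Hx0 : RtoC x <> 0) by (intros E; apply RtoC_inj in E; lra).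
rewrite Cpow_inv by assumption. rewrite <- (Rcpow_nat x n Hx).
assert (H := Rcpow_opp x (INR n)).
assert (Hne : Rcpow x (INR n) <> 0) by apply Cexp_neq_0.
apply (f_equal (fun c => / Rcpow x (INR n) * c)) in H.
rewrite Cmult_assoc, Cinv_l, Cmult_1_l, Cmult_1_r in H by assumption. exact H.
Qed.

Lemma ex_Cderiv_Rcpow x z : ex_Cderiv (fun s => Rcpow x s) z.
Proof.
apply (ex_Cderiv_comp Cexp); [apply ex_Cderiv_Cexp|].
apply ex_Cderiv_mult; [apply ex_Cderiv_id | apply ex_Cderiv_const].
Qed.

Lemma Cmod_dirichlet_term (s : C) n : (2 <= Re s)%R ->
  (Cmod (Rcpow (INR (S n)) (- s)) <= / INR (S n) ^ 2)%R.
Proof.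
intros Hs. unfold Rcpow. rewrite Cmod_Cexp.
assert (Hn : (0 < INR (S n))%R) by (apply lt_0_INR; lia).
assert (Hn1 : (1 <= INR (S n))%R) by (apply (le_INR 1); lia).
assert (Hln : (0 <= ln (INR (S n)))%R).
{ rewrite <- ln_1. destruct Hn1 as [H|H]; [left; apply ln_increasing; lra | right; now rewrite <- H]. }
replace (Re (- s * ln (INR (S n)))) with (- (Re s * ln (INR (S n))))%R
  by (destruct s; simpl; ring).
rewrite exp_Ropp. apply Rinv_le_contravar; [now apply pow_lt|].
replace (INR (S n) ^ 2)%R with (exp (2 * ln (INR (S n)))).
- assert (H : (2 * ln (INR (S n)) <= Re s * ln (INR (S n)))%R) by (apply Rmult_le_compat_r; lra).
  destruct H as [H|H]; [left; now apply exp_increasing | right; now rewrite H].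
- replace (2 * ln (INR (S n)))%R with (ln (INR (S n)) + ln (INR (S n)))%R by ring.
  rewrite exp_plus, exp_ln by assumption. ring.
Qed.

(** * The binomial series of (1 - x)^(-s) *)

Fixpoint Crising (s : C) (n : nat) : C :=
  match n with
  | O => 1
  | S n' => Crising s n' * (s + RtoC (INR n'))
  end.

(** The coefficient of x^n in (1 - x)^(-s). *)
Definition multichoose (s : C) (n : nat) : C := Crising s n / RtoC (INR (fact n)).

Lemma RtoC_INR_fact_neq_0 n : RtoC (INR (fact n)) <> 0.
Proof. intros E. apply RtoC_inj in E. now apply (INR_fact_neq_0 n). Qed.

Lemma RtoC_INR_S_neq_0 n : RtoC (INR (S n)) <> 0.
Proof. intros E. apply RtoC_inj in E. revert E. apply not_0_INR. lia. Qed.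

Lemma Cfalling_S_l z n : Cfalling z (S n) = z * Cfalling (z - 1) n.
Proof.
induction n as [|n IH]; [simpl; ring|].
change (Cfalling z (S (S n))) with (Cfalling z (S n) * (z - RtoC (INR (S n)))).
rewrite IH. change (Cfalling (z - 1) (S n)) with (Cfalling (z - 1) n * (z - 1 - RtoC (INR n))).
rewrite S_INR, RtoC_plus. ring.
Qed.

Lemma Cfalling_Crising s n : Cfalling (s + RtoC (INR n) - 1) n = Crising s n.
Proof.
induction n as [|n IH]; [reflexivity|].
rewrite Cfalling_S_l, S_INR, RtoC_plus.
replace (s + (INR n + 1) - 1 - 1) with (s + INR n - 1) by ring.
rewrite IH. simpl. ring.
Qed.

Lemma multichoose_0 s : multichoose s 0 = 1.
Proof. unfold multichoose; simpl. field. Qed.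

Lemma multichoose_S s n :
  RtoC (INR (S n)) * multichoose s (S n) = (s + INR n) * multichoose s n.
Proof.
unfold multichoose. rewrite fact_simpl, mult_INR, RtoC_mult. simpl Crising.
field. split; [apply RtoC_INR_fact_neq_0 | apply RtoC_INR_S_neq_0].
Qed.

Lemma Crising_S_l s n : Crising s (S n) = s * Crising (s + 1) n.
Proof.
induction n as [|n IH]; [simpl; ring|].
change (Crising s (S (S n))) with (Crising s (S n) * (s + RtoC (INR (S n)))).
rewrite IH. change (Crising (s + 1) (S n)) with (Crising (s + 1) n * (s + 1 + RtoC (INR n))).
rewrite S_INR, RtoC_plus. ring.
Qed.

Lemma multichoose_S_shift s n :
  RtoC (INR (S n)) * multichoose s (S n) = s * multichoose (s + 1) n.
Proof.
unfold multichoose. rewrite fact_simpl, mult_INR, RtoC_mult, Crising_S_l.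
field. split; [apply RtoC_INR_fact_neq_0 | apply RtoC_INR_S_neq_0].
Qed.

(** The ratio of consecutive coefficients is at most (A + n) / (n + 1), which
    is below 3/2 once n >= 2 A; before that, A + 1 bounds it. Any base in (1,
    2) would do as well: the coefficients are later divided by 2^n. *)
Lemma multichoose_bound (A : R) : (0 <= A)%R -> exists K, (0 < K)%R /\
  forall s n, (Cmod s <= A)%R -> (Cmod (multichoose s n) <= K * (3 / 2) ^ n)%R.
Proof.
intros HA.
destruct (INR_unbounded (2 * A)) as [n0 Hn0].
assert (step : forall s n, (Cmod s <= A)%R ->
   (INR (S n) * Cmod (multichoose s (S n)) <= (A + INR n) * Cmod (multichoose s n))%R).
{ intros s n Hs. assert (Hn := pos_INR n).
  rewrite <- (Rabs_pos_eq (INR (S n))) by apply pos_INR.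
  rewrite <- Cmod_R, <- Cmod_mult, multichoose_S, Cmod_mult.
  apply Rmult_le_compat_r; [apply Cmod_ge_0|].
  eapply Rle_trans; [apply Cmod_triangle|]. rewrite Cmod_R, Rabs_pos_eq; lra. }
assert (crude : forall s n, (Cmod s <= A)%R -> (Cmod (multichoose s n) <= (A + 1) ^ n)%R).
{ intros s n Hs. induction n as [|n IH].
  - rewrite multichoose_0, Cmod_1. simpl. lra.
  - assert (H := step s n Hs). assert (Hn := pos_INR n). rewrite S_INR in H.
    assert (Hm := Cmod_ge_0 (multichoose s n)).
    apply (Rmult_le_reg_l (INR n + 1)); [lra|]. simpl pow.
    apply Rle_trans with ((INR n + 1) * (A + 1) * Cmod (multichoose s n))%R.
    + eapply Rle_trans; [exact H|]. apply Rmult_le_compat_r; nra.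
    + rewrite Rmult_assoc. apply Rmult_le_compat_l; [lra|]. apply Rmult_le_compat_l; lra. }
exists ((A + 1) ^ n0)%R. split; [apply pow_lt; lra|].
intros s n Hs. induction n as [|n IH].
- rewrite multichoose_0, Cmod_1. simpl. rewrite Rmult_1_r. apply pow_R1_Rle. lra.
- destruct (Nat.le_gt_cases (S n) n0) as [H|H].
  + eapply Rle_trans; [now apply crude|].
    assert ((A + 1) ^ S n <= (A + 1) ^ n0)%R by (apply Rle_pow; [lra|assumption]).
    assert (1 <= (3 / 2) ^ S n)%R by (apply pow_R1_Rle; lra).
    assert (0 < (A + 1) ^ n0)%R by (apply pow_lt; lra).
    apply Rle_trans with ((A + 1) ^ n0 * 1)%R; [lra|].
    apply Rmult_le_compat_l; lra.
  + assert (Hst := step s n Hs).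
    assert (Hn : (INR n0 <= INR n)%R) by (apply le_INR; lia).
    rewrite S_INR in Hst. assert (Hn' := pos_INR n).
    assert (Hm := Cmod_ge_0 (multichoose s n)).
    apply (Rmult_le_reg_l (INR n + 1)); [lra|].
    eapply Rle_trans; [exact Hst|].
    apply Rle_trans with ((INR n + 1) * (3 / 2) * Cmod (multichoose s n))%R;
      [apply Rmult_le_compat_r; lra|].
    rewrite Rmult_assoc. apply Rmult_le_compat_l; [lra|].
    simpl pow. nra.
Qed.

(** The mean value theorem for the real and imaginary parts separately, hence
    the factor 2. *)
Lemma Cmod_increment_real_segment (G g : C -> C) (L D : R) : (0 <= L)%R ->
  (forall t, (0 <= t <= L)%R -> is_Cderiv G (RtoC t) (g (RtoC t)) /\ (Cmod (g (RtoC t)) <= D)%R) ->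
  (Cmod (G (RtoC L) - G 0) <= 2 * D * L)%R.
Proof.
intros HL HG.
assert (Der : forall t, (0 <= t <= L)%R ->
   is_derive (fun t => Re (G (RtoC t))) t (Re (g (RtoC t))) /\
   is_derive (fun t => Im (G (RtoC t))) t (Im (g (RtoC t)))).
{ intros t Ht. destruct (HG t Ht) as [Hd _].
  assert (Hp := proj1 (is_Cderiv_eps _ _ _) Hd).
  assert (E : forall eps : posreal, locally t (fun u =>
     (Cmod (G (RtoC u) - G (RtoC t) - g (RtoC t) * (u - t)%R) <= eps * Rabs (u - t))%R)).
  { intros eps. destruct (Hp eps (cond_pos eps)) as (d & Hd0 & H).
    exists (mkposreal d Hd0). intros u Hu.
    rewrite <- (Cmod_R (u - t)). rewrite RtoC_minus. apply H.
    rewrite <- RtoC_minus, Cmod_R. exact Hu. }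
  split; (split; [apply is_linear_scal_l|]); intros x Hx eps;
    rewrite <- (is_filter_lim_locally_unique (K := R_AbsRing) (V := R_NormedModule) t x Hx);
    destruct (E eps) as [d Hd']; exists d; intros u Hu;
    (eapply Rle_trans; [|exact (Hd' u Hu)]).
  - eapply Rle_trans; [|apply re_le_Cmod]. right.
    unfold norm, minus, plus, opp, scal; simpl. unfold abs, mult, plus, opp; simpl.
    f_equal. unfold Cminus, Cplus, Copp, Cmult, RtoC, Re, Im; simpl. ring.
  - eapply Rle_trans; [|apply im_le_Cmod]. right.
    unfold norm, minus, plus, opp, scal; simpl. unfold abs, mult, plus, opp; simpl.
    f_equal. unfold Cminus, Cplus, Copp, Cmult, RtoC, Re, Im; simpl. ring. }
assert (V : forall f df : R -> R, (forall t, (0 <= t <= L)%R -> is_derive f t (df t)) ->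
   (forall t, (0 <= t <= L)%R -> (Rabs (df t) <= D)%R) -> (Rabs (f L - f 0%R) <= D * L)%R).
{ intros f df Hf Hb.
  destruct (MVT_gen f 0 L df) as (c & Hcc & Heq).
  - rewrite Rmin_left, Rmax_right by lra. intros; apply Hf; lra.
  - rewrite Rmin_left, Rmax_right by lra. intros x Hx. apply derivable_continuous_pt.
    exists (df x). apply is_derive_Reals. now apply Hf.
  - rewrite Rmin_left, Rmax_right in Hcc by lra.
    rewrite Heq, Rminus_0_r, Rabs_mult, (Rabs_pos_eq L) by lra.
    apply Rmult_le_compat_r; [lra|]. now apply Hb. }
assert (VR := V _ _ (fun t Ht => proj1 (Der t Ht))
   (fun t Ht => Rle_trans _ _ _ (re_le_Cmod _) (proj2 (HG t Ht)))).
assert (VI := V _ _ (fun t Ht => proj2 (Der t Ht))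
   (fun t Ht => Rle_trans _ _ _ (im_le_Cmod _) (proj2 (HG t Ht)))).
eapply Rle_trans; [apply Cmod_le_Re_Im|].
replace (Re (G (RtoC L) - G 0)) with (Re (G (RtoC L)) - Re (G (RtoC 0)))%R by reflexivity.
replace (Im (G (RtoC L) - G 0)) with (Im (G (RtoC L)) - Im (G (RtoC 0)))%R by reflexivity.
simpl in VR, VI. lra.
Qed.

Definition binomial_partial (s x : C) (M : nat) : C :=
  Csum (fun m => multichoose s m * x ^ m) M.

Lemma is_Cderiv_eq f z l l' : l = l' -> is_Cderiv f z l -> is_Cderiv f z l'.
Proof. now intros ->. Qed.

Lemma is_Cderiv_Cexp_lin c y : is_Cderiv (fun y => Cexp (c * y)) y (c * Cexp (c * y)).
Proof.
apply (is_Cderiv_comp Cexp (fun y => c * y)); [apply is_Cderiv_Cexp|].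
apply (is_Cderiv_eq _ _ (0 * y + c * 1)); [ring|].
apply is_Cderiv_mult; [apply is_Cderiv_const | apply is_Cderiv_id].
Qed.

Lemma is_Cderiv_pow f z l n : is_Cderiv f z l ->
  is_Cderiv (fun w => f w ^ S n) z (INR (S n) * l * f z ^ n).
Proof.
intros Hf. induction n as [|n IH].
- apply (is_Cderiv_ext f); [intros w; simpl; ring|].
  apply (is_Cderiv_eq _ _ l); [simpl; ring | assumption].
- apply (is_Cderiv_eq _ _ (l * f z ^ S n + f z * (INR (S n) * l * f z ^ n))).
  + rewrite (S_INR (S n)), RtoC_plus. simpl Cpow. ring.
  + exact (is_Cderiv_mult _ _ _ _ _ Hf IH).
Qed.

(** Substituting x = 1 - e^(-y) makes (1 - x)^s T_M(x) an entire function of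
    y, with no logarithm. Its derivative telescopes, by (m+1) c(s,m+1) = (s+m)
    c(s,m), to a single term. *)
Lemma binomial_partial_derivative s y M :
  is_Cderiv (fun y => Cexp (- s * y) * binomial_partial s (1 - Cexp (- (1) * y)) M) y
    (- (Cexp (- s * y) * (RtoC (INR (S M)) * multichoose s (S M)) * (1 - Cexp (- (1) * y)) ^ M)).
Proof.
set (x := fun y => 1 - Cexp (- (1) * y)).
assert (Hx : is_Cderiv x y (1 - x y)).
{ apply (is_Cderiv_eq _ _ (0 - - (1) * Cexp (- (1) * y))); [unfold x; ring|].
  apply is_Cderiv_minus; [apply is_Cderiv_const | apply is_Cderiv_Cexp_lin]. }
induction M as [|M IH].
- apply (is_Cderiv_ext (fun y => Cexp (- s * y))).
  + intros t. unfold binomial_partial. rewrite Csum_0, multichoose_0. simpl.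
    now rewrite !Cmult_1_r.
  + apply (is_Cderiv_eq _ _ (- s * Cexp (- s * y))); [|apply is_Cderiv_Cexp_lin].
    rewrite multichoose_S, multichoose_0. simpl. ring.
- apply (is_Cderiv_ext (fun y => Cexp (- s * y) * binomial_partial s (x y) M
       + multichoose s (S M) * (Cexp (- s * y) * x y ^ S M))).
  + intros t. unfold binomial_partial. rewrite Csum_S. fold (x t). ring.
  + eapply is_Cderiv_eq; [|apply is_Cderiv_plus; [exact IH|];
      apply is_Cderiv_mult; [apply is_Cderiv_const|];
      apply is_Cderiv_mult; [apply is_Cderiv_Cexp_lin | apply is_Cderiv_pow; exact Hx]].
    fold (x y). rewrite (multichoose_S s (S M)). simpl Cpow. ring.
Qed.

(** For 0 <= x <= 1/2, that is 0 <= y <= ln 2, the derivative computed in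
    [binomial_partial_derivative] is O((3/2)^M (1/2)^M), and (1 - x)^s T_M(x)
    is 1 at y = 0. *)
Lemma binomial_series_uniform (s : C) : exists K, (0 < K)%R /\ forall x M, (0 <= x <= 1 / 2)%R ->
   (Cmod (Cexp (- s * RtoC (ln (1 - x))) - binomial_partial s (RtoC x) M) <= K * (3 / 4) ^ M)%R.
Proof.
assert (Hs0 := Cmod_ge_0 s).
destruct (multichoose_bound (Cmod s + 1)) as (K & HK & Hb); [lra|].
exists (2 * exp (Cmod s) * exp (Cmod s) * (Cmod s + 1) * K)%R.
assert (HE := exp_pos (Cmod s)).
split; [repeat apply Rmult_lt_0_compat; lra|].
intros x M Hx.
(* The value of y that corresponds to x. *)
set (L := (- ln (1 - x))%R).
assert (HL0 : (0 <= L)%R).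
{ unfold L. rewrite <- ln_1 at 1.
  destruct (proj1 Hx) as [H|H].
  - assert (ln (1 - x) < ln 1)%R by (apply ln_increasing; lra). rewrite ln_1 in *. lra.
  - rewrite <- H, Rminus_0_r, ln_1. lra. }
assert (HL1 : (L <= 1)%R).
{ unfold L. apply Ropp_le_cancel. rewrite Ropp_involutive.
  rewrite <- (ln_exp (- (1))).
  assert (exp (- (1)) <= 1 - x)%R.
  { rewrite exp_Ropp.
    assert (2 < exp 1)%R by (generalize (exp_ineq1 1 ltac:(lra)); lra).
    apply Rle_trans with (/ 2)%R; [apply Rinv_le_contravar; lra | lra]. }
  destruct H as [H|H]; [left; apply ln_increasing; [apply exp_pos | assumption] | right; now rewrite H]. }
assert (HxL : 1 - Cexp (- (1) * RtoC L) = RtoC x).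
{ replace (- (1) * RtoC L) with (RtoC (ln (1 - x))) by (unfold L; rewrite RtoC_opp; ring).
  unfold Cexp; simpl. rewrite cos_0, sin_0, exp_ln by lra.
  apply injective_projections; simpl; ring. }
set (G := fun y => Cexp (- s * y) * binomial_partial s (1 - Cexp (- (1) * y)) M).
assert (Hexp : forall t, (0 <= t <= 1)%R -> forall u, Cmod u = Cmod s ->
  (Cmod (Cexp (u * RtoC t)) <= exp (Cmod s))%R).
{ intros t Ht u Hu. rewrite Cmod_Cexp.
  assert (H : (Re (u * RtoC t) <= Cmod s)%R).
  { eapply Rle_trans; [apply Rle_abs|]. eapply Rle_trans; [apply re_le_Cmod|].
    rewrite Cmod_mult, Cmod_R, Rabs_pos_eq, Hu by lra. nra. }
  destruct H as [H|H]; [left; now apply exp_increasing | right; now rewrite H]. }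
set (D := (exp (Cmod s) * ((Cmod s + 1) * K) * (3 / 4) ^ M)%R).
assert (HG : (Cmod (G (RtoC L) - G 0) <= 2 * D * L)%R).
{ apply Cmod_increment_real_segment with (g := fun y =>
    - (Cexp (- s * y) * (RtoC (INR (S M)) * multichoose s (S M))
       * (1 - Cexp (- (1) * y)) ^ M)); [assumption|].
  intros t Ht. split; [apply binomial_partial_derivative|].
  rewrite multichoose_S_shift, Cmod_opp, !Cmod_mult, Cmod_pow.
  unfold D.
  assert (Hx1 : (Cmod (1 - Cexp (- (1) * RtoC t)) <= 1 / 2)%R).
  { replace (1 - Cexp (- (1) * RtoC t)) with (RtoC (1 - exp (- t))).
    2:{ unfold Cexp, Cmult; simpl. apply injective_projections; simpl.
        - replace (- (1) * 0 + - 0 * t)%R with 0%R by ring. rewrite cos_0.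
          replace (- (1) * t - - 0 * 0)%R with (- t)%R by ring. ring.
        - replace (- (1) * 0 + - 0 * t)%R with 0%R by ring. rewrite sin_0. ring. }
    rewrite Cmod_R.
    assert (exp (- L) <= exp (- t))%R.
    { destruct (Rle_lt_or_eq_dec t L ltac:(lra)) as [H| ->]; [left; apply exp_increasing; lra | lra]. }
    assert (exp (- L) = 1 - x)%R by (unfold L; rewrite Ropp_involutive; apply exp_ln; lra).
    assert (exp (- t) <= 1)%R.
    { rewrite <- exp_0. destruct (Rle_lt_or_eq_dec 0 t ltac:(lra)) as [H1| <-];
       [left; apply exp_increasing; lra | rewrite Ropp_0; lra]. }
    apply Rabs_le_between; lra. }
  assert (Hm1 : (Cmod (multichoose (s + 1) M) <= K * (3 / 2) ^ M)%R).
  { apply Hb. eapply Rle_trans; [apply Cmod_triangle|]. rewrite Cmod_1. lra. }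
  assert (Hp : (Cmod (1 - Cexp (- (1) * RtoC t)) ^ M <= (1 / 2) ^ M)%R)
    by (apply pow_incr; split; [apply Cmod_ge_0 | assumption]).
  replace ((3 / 4) ^ M)%R with ((3 / 2) ^ M * (1 / 2) ^ M)%R
    by (rewrite <- Rpow_mult_distr; f_equal; lra).
  replace (exp (Cmod s) * ((Cmod s + 1) * K) * ((3 / 2) ^ M * (1 / 2) ^ M))%R
    with (exp (Cmod s) * ((Cmod s + 1) * (K * (3 / 2) ^ M)) * (1 / 2) ^ M)%R by ring.
  assert (Hc0 := Cmod_ge_0 (multichoose (s + 1) M)).
  apply Rmult_le_compat; [| apply pow_le, Cmod_ge_0 | | exact Hp].
  - apply Rmult_le_pos; [apply Cmod_ge_0|]. now apply Rmult_le_pos.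
  - apply Rmult_le_compat; [apply Cmod_ge_0 | now apply Rmult_le_pos | |].
    + apply Hexp; [lra | apply Cmod_opp].
    + apply Rmult_le_compat; lra. }
assert (HG0 : G 0 = 1).
{ unfold G. rewrite !Cmult_0_r, Cexp_0.
  replace (1 - 1) with (RtoC 0) by ring. unfold binomial_partial.
  assert (H : forall n, Csum (fun m => multichoose s m * 0 ^ m) n = RtoC 1).
  { induction n as [|n IH]; [rewrite Csum_0, multichoose_0; simpl; ring|].
    rewrite Csum_S, IH. simpl. ring. }
  rewrite H. ring. }
rewrite HG0 in HG.
replace (Cexp (- s * RtoC (ln (1 - x))) - binomial_partial s (RtoC x) M)
  with (Cexp (s * RtoC L) * (- (G (RtoC L) - 1))).
2:{ unfold G. rewrite HxL.
  replace (Cexp (- s * RtoC (ln (1 - x)))) with (Cexp (s * RtoC L))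
    by (unfold L; rewrite RtoC_opp; f_equal; ring).
  assert (Hone : Cexp (s * RtoC L) * Cexp (- s * RtoC L) = 1).
  { rewrite <- Cexp_plus. replace (s * RtoC L + - s * RtoC L) with (RtoC 0) by ring. apply Cexp_0. }
  transitivity (Cexp (s * RtoC L) - Cexp (s * RtoC L) * Cexp (- s * RtoC L) * binomial_partial s (RtoC x) M);
   [ring | rewrite Hone; ring]. }
rewrite Cmod_mult, Cmod_opp.
apply Rle_trans with (exp (Cmod s) * (2 * D * L))%R.
- apply Rmult_le_compat; try apply Cmod_ge_0; [now apply Hexp | assumption].
- unfold D.
  assert (0 < (3 / 4) ^ M)%R by (apply pow_lt; lra).
  set (E := exp (Cmod s)) in *. set (P := ((3 / 4) ^ M)%R) in *.
  replace (2 * E * E * (Cmod s + 1) * K * P)%R with (E * (2 * (E * ((Cmod s + 1) * K) * P) * 1))%R by ring.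
  apply Rmult_le_compat_l; [lra|]. apply Rmult_le_compat_l; [|assumption].
  apply Rmult_le_pos; [lra|]. repeat apply Rmult_le_pos; lra.
Qed.

Lemma tends_to_0_geometric (a : nat -> C) (K : R) N0 :
  (forall N, (N0 <= N)%nat -> (Cmod (a N) <= K * (3 / 4) ^ N)%R) -> tends_to_0 a.
Proof.
intros Ha eps Heps.
destruct (pow_lt_1_zero (3 / 4)) with (y := (eps / (Rabs K + 1))%R) as [N1 HN1].
- rewrite Rabs_pos_eq; lra.
- apply Rdiv_lt_0_compat; [lra|]. generalize (Rabs_pos K); lra.
- exists (max N0 N1). intros N HN. eapply Rle_trans; [apply Ha; lia|].
  specialize (HN1 N ltac:(lia)).
  assert (Hp : (0 < (3 / 4) ^ N)%R) by (apply pow_lt; lra).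
  rewrite Rabs_pos_eq in HN1 by lra.
  assert (HK := Rabs_pos K). assert (HK' := Rle_abs K).
  apply (Rmult_lt_compat_r (Rabs K + 1)) in HN1; [|lra].
  replace (eps / (Rabs K + 1) * (Rabs K + 1))%R with eps in HN1 by (field; lra). nra.
Qed.

Lemma is_Cseries_mult (c : C) (a : nat -> C) (l : C) :
  is_Cseries a l -> is_Cseries (fun n => c * a n) (c * l).
Proof. exact (is_series_scal (K := C_AbsRing) (V := C_NormedModule) c a l). Qed.

Lemma is_Cseries_plus (a b : nat -> C) (la lb : C) : is_Cseries a la -> is_Cseries b lb ->
  is_Cseries (fun n => a n + b n) (la + lb).
Proof. exact (is_series_plus (K := C_AbsRing) (V := C_NormedModule) a b la lb). Qed.

Lemma is_Cseries_minus (a b : nat -> C) (la lb : C) : is_Cseries a la -> is_Cseries b lb ->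
  is_Cseries (fun n => a n - b n) (la - lb).
Proof. exact (is_series_minus (K := C_AbsRing) (V := C_NormedModule) a b la lb). Qed.

Lemma is_Cseries_ext (a b : nat -> C) (l : C) :
  (forall n, a n = b n) -> is_Cseries a l -> is_Cseries b l.
Proof. exact (is_series_ext (K := C_AbsRing) (V := C_NormedModule) a b l). Qed.

(** * The half-shift formula for zeta *)

Section Zeta.
Variable zeta : C -> C.
Hypothesis Hzeta : is_riemann_zeta zeta.

Lemma ex_Cderiv_zeta (z : C) : z <> 1 -> ex_Cderiv zeta z.
Proof. intros Hz. apply ex_Cderiv_of_ex_derive. apply (zeta_holomorphic _ Hzeta). exact Hz. Qed.

Lemma Cmod_zeta_le_2 z : (2 <= Re z)%R -> (Cmod (zeta z) <= 2)%R.
Proof.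
intros Hz.
assert (H := zeta_dirichlet _ Hzeta z ltac:(lra)).
apply (Cmod_Cseries_le _ (fun k => / INR (S k) ^ 2)%R _ _ H).
- intros k. now apply Cmod_dirichlet_term.
- apply sum_inv_squares_le.
Qed.

(** The error made in the half-shift formula by stopping the sum at N. *)
Definition half_shift_defect (N : nat) (s : C) : C :=
  (Rcpow 2 s - 1) * zeta s
  - Csum (fun m => multichoose s m * (zeta (s + RtoC (INR m)) / 2 ^ m)) N.

Lemma INR_S_pos n : (0 < INR (S n))%R.
Proof. apply lt_0_INR; lia. Qed.

Lemma Re_plus_INR s n : Re (s + RtoC (INR n)) = (Re s + INR n)%R.
Proof. reflexivity. Qed.

(** The even denominators contribute 2^(-s) zeta(s); the two halves are
    compared along partial sums with an even number of terms. *)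
Lemma is_Cseries_odd_dirichlet s : (2 <= Re s)%R ->
  is_Cseries (fun n => Rcpow (INR (2 * n + 1)) (- s)) ((1 - Rcpow 2 (- s)) * zeta s).
Proof.
intros Hs.
assert (Hz := zeta_dirichlet _ Hzeta s ltac:(lra)).
set (a := fun n => Rcpow (INR (S n)) (- s)) in *.
assert (Heven : is_Cseries (fun n => Rcpow (INR (2 * n + 2)) (- s)) (Rcpow 2 (- s) * zeta s)).
{ apply (is_Cseries_ext (fun n => Rcpow 2 (- s) * a n)); [|now apply is_Cseries_mult].
  intros n. unfold a. rewrite <- Rcpow_mult_base; [|lra|apply INR_S_pos].
  f_equal. rewrite plus_INR, mult_INR, S_INR. simpl. ring. }
apply is_Cseries_tends.
assert (Hpair : forall N, Csum (fun n => Rcpow (INR (2 * n + 1)) (- s)) N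
   = Csum a (2 * N + 1) - Csum (fun n => Rcpow (INR (2 * n + 2)) (- s)) N :> C).
{ assert (E : forall k, a (2 * k)%nat = Rcpow (INR (2 * k + 1)) (- s) /\
                   a (2 * k + 1)%nat = Rcpow (INR (2 * k + 2)) (- s)).
  { intros k. unfold a. split; do 2 f_equal; lia. }
  induction N as [|N IH].
  - rewrite !Csum_0. change (2 * 0 + 1)%nat with 1%nat. rewrite Csum_S, Csum_0.
    destruct (E O) as [E1 E2]. simpl in E1, E2 |- *. rewrite E1, E2. ring.
  - rewrite !Csum_S, IH. replace (2 * S N + 1)%nat with (S (S (2 * N + 1))) by lia.
    rewrite !Csum_S. replace (S (S (2 * N + 1))) with (2 * S N + 1)%nat by lia.
    replace (S (2 * N + 1)) with (2 * S N)%nat by lia.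
    destruct (E (S N)) as [-> ->]. ring. }
assert (T1 := proj1 (is_Cseries_tends _ _) Hz).
assert (T2 := proj1 (is_Cseries_tends _ _) Heven).
intros eps Heps.
destruct (T1 (eps / 2)%R ltac:(lra)) as [N1 H1].
destruct (T2 (eps / 2)%R ltac:(lra)) as [N2 H2].
exists (max N1 N2). intros N HN. rewrite Hpair.
match goal with |- (Cmod ?x <= _)%R => replace x with
  ((Csum a (2 * N + 1) - zeta s) +
   - (Csum (fun n => Rcpow (INR (2 * n + 2)) (- s)) N - Rcpow 2 (- s) * zeta s)) by ring end.
eapply Rle_trans; [apply Cmod_triangle|]. rewrite Cmod_opp.
generalize (H1 (2 * N + 1)%nat ltac:(lia)), (H2 N ltac:(lia)). lra.
Qed.

Lemma is_Cseries_binomial_partial s M : (2 <= Re s)%R ->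
  is_Cseries (fun n => Rcpow (INR (S n)) (- s) * binomial_partial s (RtoC (/ (2 * INR (S n)))) M)
    (Csum (fun m => multichoose s m * (zeta (s + RtoC (INR m)) / 2 ^ m)) M).
Proof.
intros Hs.
assert (term : forall m, is_Cseries
   (fun n => Rcpow (INR (S n)) (- s) * (multichoose s m * RtoC (/ (2 * INR (S n))) ^ m))
   (multichoose s m * (zeta (s + RtoC (INR m)) / 2 ^ m))).
{ intros m.
  apply (is_Cseries_ext (fun n => multichoose s m / 2 ^ m *
            Rcpow (INR (S n)) (- (s + RtoC (INR m))))).
  - intros n. assert (Hn := INR_S_pos n).
    replace (- (s + RtoC (INR m))) with (- s + - RtoC (INR m)) by ring.
    rewrite Rcpow_plus, Rcpow_opp_nat by assumption.
    rewrite Rinv_mult, RtoC_mult, Cpow_mult_l, RtoC_inv, RtoC_inv by lra.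
    assert (H2 : RtoC 2 <> 0) by (intros E; apply RtoC_inj in E; lra).
    rewrite (Cpow_inv (RtoC 2)) by assumption.
    unfold Cdiv. ring.
  - replace (multichoose s m * (zeta (s + INR m) / 2 ^ m))
      with (multichoose s m / 2 ^ m * zeta (s + INR m)) by (unfold Cdiv; ring).
    apply is_Cseries_mult. apply (zeta_dirichlet _ Hzeta).
    rewrite Re_plus_INR. generalize (pos_INR m); lra. }
induction M as [|M IH].
- rewrite Csum_0. unfold binomial_partial.
  eapply is_Cseries_ext; [|apply (term O)]. intros n. now rewrite Csum_0.
- rewrite Csum_S. eapply is_Cseries_ext; [|apply (is_Cseries_plus _ _ _ _ IH (term (S M)))].
  intros n. unfold binomial_partial. rewrite Csum_S. simpl. ring.
Qed.

(** Both sides are series over n with common factor n^(-s), and the terms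
    differ by the remainder of the binomial series of (1 - x)^(-s) at x =
    1/(2n), uniformly small in n. *)
Lemma half_shift_defect_right s : (2 <= Re s)%R ->
  tends_to_0 (fun N => half_shift_defect N s).
Proof.
intros Hs.
destruct (binomial_series_uniform s) as (K & HK & Hunif).
apply (tends_to_0_geometric _ (2 * K) O). intros N _.
assert (Hodd := is_Cseries_mult (Rcpow 2 s) _ _ (is_Cseries_odd_dirichlet s Hs)).
assert (Hbin := is_Cseries_binomial_partial s N Hs).
assert (H := is_Cseries_minus _ _ _ _ Hodd Hbin).
replace (Rcpow 2 s * ((1 - Rcpow 2 (- s)) * zeta s)) with ((Rcpow 2 s - 1) * zeta s) in H.
2:{ transitivity ((Rcpow 2 s - Rcpow 2 s * Rcpow 2 (- s)) * zeta s); [|ring].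
    now rewrite Rcpow_opp. }
fold (half_shift_defect N s) in H.
assert (Hp : (0 < (3 / 4) ^ N)%R) by (apply pow_lt; lra).
apply (Cmod_Cseries_le _ (fun n => K * (3 / 4) ^ N * / INR (S n) ^ 2)%R _ _ H).
- intros n. assert (Hn := INR_S_pos n).
  assert (Hn1 : (1 <= INR (S n))%R) by (apply (le_INR 1); lia).
  assert (Hx : (0 < / (2 * INR (S n)) <= 1 / 2)%R).
  { split; [apply Rinv_0_lt_compat; lra|]. unfold Rdiv. rewrite Rmult_1_l.
    apply Rinv_le_contravar; lra. }
  replace (Rcpow 2 s * Rcpow (INR (2 * n + 1)) (- s)) with
    (Rcpow (INR (S n)) (- s) * Cexp (- s * RtoC (ln (1 - / (2 * INR (S n)))))).
  + replace (Rcpow (INR (S n)) (- s) * Cexp (- s * RtoC (ln (1 - / (2 * INR (S n)))))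
      - Rcpow (INR (S n)) (- s) * binomial_partial s (RtoC (/ (2 * INR (S n)))) N)
     with (Rcpow (INR (S n)) (- s) * (Cexp (- s * RtoC (ln (1 - / (2 * INR (S n)))))
        - binomial_partial s (RtoC (/ (2 * INR (S n)))) N)) by ring.
    rewrite Cmod_mult, Rmult_comm.
    apply Rmult_le_compat; try apply Cmod_ge_0.
    * apply Hunif. lra.
    * now apply Cmod_dirichlet_term.
  + change (Cexp (- s * RtoC (ln (1 - / (2 * INR (S n)))))) with (Rcpow (1 - / (2 * INR (S n))) (- s)).
    rewrite <- Rcpow_mult_base by lra.
    replace (INR (2 * n + 1)) with (2 * (INR (S n) * (1 - / (2 * INR (S n)))))%R.
    2:{ rewrite plus_INR, mult_INR. rewrite S_INR in *. simpl. field. lra. }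
    assert (0 < INR (S n) * (1 - / (2 * INR (S n))))%R by (apply Rmult_lt_0_compat; lra).
    rewrite (Rcpow_mult_base 2) by lra.
    rewrite Cmult_assoc, Rcpow_opp. ring.
- intros n.
  replace (sum_n (fun k => (K * (3 / 4) ^ N * / INR (S k) ^ 2)%R) n)
    with (K * (3 / 4) ^ N * sum_n (fun k => / INR (S k) ^ 2)%R n)%R
    by (symmetry; apply (sum_n_mult_l (K := R_Ring))).
  replace (2 * K * (3 / 4) ^ N)%R with (K * (3 / 4) ^ N * 2)%R by ring.
  apply Rmult_le_compat_l; [apply Rmult_le_pos; lra | apply sum_inv_squares_le].
Qed.

Lemma half_shift_defect_differentiable N z : (forall m, z + RtoC (INR m) <> 1) ->
  ex_Cderiv (half_shift_defect N) z.
Proof.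
intros Hz. unfold half_shift_defect.
assert (Hz0 : z <> 1) by (intros E; apply (Hz O); simpl; rewrite E; ring).
apply ex_Cderiv_minus.
{ apply ex_Cderiv_mult; [|now apply ex_Cderiv_zeta].
  apply ex_Cderiv_minus; [apply ex_Cderiv_Rcpow | apply ex_Cderiv_const]. }
assert (Hrise : forall m, ex_Cderiv (fun s => Crising s m) z).
{ induction m as [|m IH]; simpl.
  - exact (ex_Cderiv_const 1 z).
  - apply (ex_Cderiv_mult (fun s => Crising s m) (fun s => s + RtoC (INR m))); [exact IH|].
    apply ex_Cderiv_plus; [apply ex_Cderiv_id | apply ex_Cderiv_const]. }
assert (Hterm : forall m, ex_Cderiv
   (fun s => multichoose s m * (zeta (s + RtoC (INR m)) / 2 ^ m)) z).
{ intros m. apply ex_Cderiv_mult.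
  - unfold multichoose, Cdiv. apply ex_Cderiv_mult; [apply Hrise | apply ex_Cderiv_const].
  - unfold Cdiv. apply ex_Cderiv_mult; [|apply ex_Cderiv_const].
    apply (ex_Cderiv_comp zeta (fun s => s + RtoC (INR m))); [now apply ex_Cderiv_zeta|].
    apply ex_Cderiv_plus; [apply ex_Cderiv_id | apply ex_Cderiv_const]. }
induction N as [|N IH].
- destruct (Hterm O) as [l Hl]. exists l. eapply is_Cderiv_ext; [|exact Hl].
  intros w. now rewrite Csum_0.
- destruct (ex_Cderiv_plus _ _ _ IH (Hterm (S N))) as [l Hl]. exists l.
  eapply is_Cderiv_ext; [|exact Hl]. intros w. now rewrite Csum_S.
Qed.

(** For m >= |z| + 2 the factor zeta(z + m) is at most 2 in modulus, so the
    m-th term is at most 2 K (3/4)^m. *)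
Lemma half_shift_defect_cauchy A eps : (0 < eps)%R -> exists N0, forall N N' z,
  (N0 <= N)%nat -> (N0 <= N')%nat -> (Cmod z <= A)%R ->
  (Cmod (half_shift_defect N z - half_shift_defect N' z) <= eps)%R.
Proof.
intros Heps.
destruct (multichoose_bound (Rmax A 0) (Rmax_r A 0)) as (K & HK & Hb).
destruct (INR_unbounded (A + 2)) as [m0 Hm0].
assert (step : forall N n z, (m0 <= N)%nat -> (Cmod z <= A)%R ->
  (Cmod (half_shift_defect N z - half_shift_defect (N + n) z)
     <= 8 * K * ((3 / 4) ^ N - (3 / 4) ^ (N + n)))%R).
{ intros N n z HN Hz. induction n as [|n IH].
  - rewrite Nat.add_0_r. replace (half_shift_defect N z - half_shift_defect N z) with (RtoC 0) by ring.
    rewrite Cmod_0. lra.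
  - rewrite Nat.add_succ_r.
    replace (half_shift_defect N z - half_shift_defect (S (N + n)) z)
     with ((half_shift_defect N z - half_shift_defect (N + n) z)
       + multichoose z (S (N + n)) * (zeta (z + RtoC (INR (S (N + n)))) / 2 ^ (S (N + n)))).
    2:{ unfold half_shift_defect. rewrite Csum_S. ring. }
    eapply Rle_trans; [apply Cmod_triangle|].
    assert (Hlast : (Cmod (multichoose z (S (N + n))
        * (zeta (z + RtoC (INR (S (N + n)))) / 2 ^ (S (N + n))))
        <= 2 * K * (3 / 4) ^ (S (N + n)))%R).
    { assert (H2 : RtoC 2 <> 0) by (intros E; apply RtoC_inj in E; lra).
      rewrite Cmod_mult, Cmod_div, Cmod_pow, Cmod_R, (Rabs_pos_eq 2) by (lra || now apply Cpow_nz).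
      set (m := S (N + n)).
      assert (Hm : (Cmod (zeta (z + RtoC (INR m))) <= 2)%R).
      { apply Cmod_zeta_le_2. rewrite Re_plus_INR.
        assert (INR m0 <= INR m)%R by (apply le_INR; lia).
        generalize (re_le_Cmod z). intros Hre. apply Rle_trans with (1 := Hre) in Hz.
        apply Rabs_le_between in Hz. lra. }
      assert (Hc : (Cmod (multichoose z m) <= K * (3 / 2) ^ m)%R).
      { apply Hb. eapply Rle_trans; [exact Hz | apply Rmax_l]. }
      assert (Hp2 : (0 < / 2 ^ m)%R) by (apply Rinv_0_lt_compat, pow_lt; lra).
      replace (2 * K * (3 / 4) ^ m)%R with (K * (3 / 2) ^ m * (2 * / 2 ^ m))%R.
      - apply Rmult_le_compat; [apply Cmod_ge_0 | | exact Hc |].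
        + apply Rmult_le_pos; [apply Cmod_ge_0 | lra].
        + apply Rmult_le_compat_r; lra.
      - replace (3 / 4)%R with (3 / 2 * / 2)%R by lra.
        rewrite Rpow_mult_distr, pow_inv. ring. }
    simpl pow in *. set (p := ((3 / 4) ^ (N + n))%R) in *. 
    assert (0 < p)%R by (apply pow_lt; lra). nra. }
assert (bound : forall N N' z, (m0 <= N)%nat -> (N <= N')%nat -> (Cmod z <= A)%R ->
  (Cmod (half_shift_defect N z - half_shift_defect N' z) <= 8 * K * (3 / 4) ^ N)%R).
{ intros N N' z HN HN' Hz. replace N' with (N + (N' - N))%nat by lia.
  eapply Rle_trans; [now apply step|].
  assert (0 < (3 / 4) ^ (N + (N' - N)))%R by (apply pow_lt; lra).
  apply Rmult_le_compat_l; lra. }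
destruct (pow_lt_1_zero (3 / 4)) with (y := (eps / (8 * K))%R) as [N1 HN1].
- rewrite Rabs_pos_eq; lra.
- apply Rdiv_lt_0_compat; lra.
- assert (small : forall N, (N1 <= N)%nat -> (8 * K * (3 / 4) ^ N <= eps)%R).
  { intros N HN. specialize (HN1 N HN). rewrite Rabs_pos_eq in HN1 by (apply pow_le; lra).
    apply (Rmult_lt_compat_l (8 * K)) in HN1; [|lra].
    replace (8 * K * (eps / (8 * K)))%R with eps in HN1 by (field; lra). lra. }
  exists (max m0 N1). intros N N' z HN HN' Hz.
  destruct (Nat.le_ge_cases N N') as [H|H].
  + eapply Rle_trans; [apply bound; (assumption || lia) | apply small; lia].
  + rewrite <- Cmod_opp.
    replace (- (half_shift_defect N z - half_shift_defect N' z))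
      with (half_shift_defect N' z - half_shift_defect N z) by ring.
    eapply Rle_trans; [apply bound; (assumption || lia) | apply small; lia].
Qed.

Lemma Im_nonzero_regular z m : Im z <> 0%R -> z + RtoC (INR m) <> 1.
Proof.
intros Hz E. apply Hz. apply (f_equal Im) in E.
unfold Im, Cplus, RtoC in *; simpl in E. lra.
Qed.

Lemma half_shift_defect_nonreal z : Im z <> 0%R -> tends_to_0 (fun N => half_shift_defect N z).
Proof.
intros Hz.
set (sg := if Rlt_dec 0 (Im z) then 1%R else (-1)%R).
apply (tends_to_0_half_plane half_shift_defect 2 sg).
- unfold sg. destruct (Rlt_dec 0 (Im z)); [now left | now right].
- intros N w Hw. apply half_shift_defect_differentiable. intros m.
  apply Im_nonzero_regular. intros E. rewrite E in Hw. lra.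
- apply half_shift_defect_cauchy.
- apply half_shift_defect_right.
- unfold sg. destruct (Rlt_dec 0 (Im z)); lra.
Qed.

(** Real points are limits of nonreal ones; the uniform Cauchy property lets
    the limits in N and in z be exchanged. *)
Lemma half_shift_defect_limit z : (forall m, z + RtoC (INR m) <> 1) ->
  tends_to_0 (fun N => half_shift_defect N z).
Proof.
intros Hz. destruct (Req_dec (Im z) 0) as [Hi|Hi]; [|now apply half_shift_defect_nonreal].
intros eps Heps.
destruct (half_shift_defect_cauchy (Cmod z + 1) (eps / 4)) as [N0 HN0]; [lra|].
exists N0. intros N HN.
destruct (Cderiv_continuous (half_shift_defect N) z) with (eps := (eps / 4)%R) as (d & Hd & Hcont);
 [now apply half_shift_defect_differentiable | lra|].
set (h := (Rmin 1 d / 2)%R).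
assert (Hm : (0 < Rmin 1 d)%R) by (apply Rmin_pos; lra).
assert (Hm1 := Rmin_l 1 d). assert (Hm2 := Rmin_r 1 d).
set (w := z + Ci * RtoC h).
assert (Hwz : Cmod (w - z) = h).
{ unfold w. replace (z + Ci * RtoC h - z) with (Ci * RtoC h) by ring.
  rewrite Cmod_mult, Cmod_Ci, Cmod_R, Rabs_pos_eq by (unfold h; lra). ring. }
assert (Hlim : tends_to_0 (fun N => half_shift_defect N w)).
{ apply half_shift_defect_nonreal.
  replace (Im w) with (Im z + h)%R by (unfold w; destruct z; simpl; ring).
  rewrite Hi. unfold h. lra. }
destruct (Hlim (eps / 4)%R ltac:(lra)) as [N2 HN2].
assert (B1 := Hcont w ltac:(rewrite Hwz; unfold h; lra)).
assert (Hw : (Cmod w <= Cmod z + 1)%R).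
{ unfold w. eapply Rle_trans; [apply Cmod_triangle|].
  rewrite Cmod_mult, Cmod_Ci, Cmod_R, Rabs_pos_eq by (unfold h; lra). unfold h. lra. }
assert (B2 := HN0 N (max N0 N2) w HN ltac:(lia) Hw).
assert (B3 := HN2 (max N0 N2) ltac:(lia)).
replace (half_shift_defect N z) with
  (- (half_shift_defect N w - half_shift_defect N z)
   + ((half_shift_defect N w - half_shift_defect (max N0 N2) w) + half_shift_defect (max N0 N2) w)) by ring.
eapply Rle_trans; [apply Cmod_triangle|]. rewrite Cmod_opp.
apply Rle_trans with (eps / 4 + (eps / 4 + eps / 4))%R; [|lra].
apply Rplus_le_compat; [lra|].
eapply Rle_trans; [apply Cmod_triangle|]. lra.
Qed.

Lemma zeta_half_shift z : (forall m, z + RtoC (INR m) <> 1) ->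
  is_Cseries (fun m => multichoose z m * (zeta (z + RtoC (INR m)) / 2 ^ m))
    ((Rcpow 2 z - 1) * zeta z).
Proof.
intros Hz. apply is_Cseries_tends. intros eps Heps.
destruct (half_shift_defect_limit z Hz eps Heps) as [N0 HN0].
exists N0. intros N HN. rewrite <- Cmod_opp.
eapply Rle_trans; [|apply (HN0 N HN)]. right. f_equal. unfold half_shift_defect. ring.
Qed.
End Zeta.

(** * Finite sums and binomial coefficients *)

Lemma Csum_ext (a b : nat -> C) n : (forall k, (k <= n)%nat -> a k = b k) ->
  Csum a n = Csum b n :> C.
Proof. intros H. exact (sum_n_ext_loc (G := C_AbelianMonoid) a b n H). Qed.

Lemma Csum_mult_l (c : C) (a : nat -> C) n : Csum (fun k => c * a k) n = c * Csum a n :> C.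
Proof. exact (sum_n_mult_l (K := C_Ring) c a n). Qed.

Lemma Csum_plus (a b : nat -> C) n : Csum (fun k => a k + b k) n = Csum a n + Csum b n :> C.
Proof. exact (sum_n_plus (G := C_AbelianMonoid) a b n). Qed.

Lemma Csum_RtoC (f : nat -> R) n : Csum (fun k => RtoC (f k)) n = RtoC (sum_f_R0 f n) :> C.
Proof.
induction n as [|n IH]; [now rewrite Csum_0|].
rewrite Csum_S, IH. simpl sum_f_R0. now rewrite RtoC_plus.
Qed.

Lemma Csum_shift (f : nat -> C) j d :
  sum_n_m (G := C_AbelianMonoid) f j (j + d) = Csum (fun l => f (j + l)%nat) d :> C.
Proof.
induction d as [|d IH].
- rewrite Nat.add_0_r, Csum_0, Nat.add_0_r. apply (sum_n_n (G := C_AbelianMonoid)).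
- rewrite Nat.add_succ_r, Csum_S, <- IH.
  rewrite (sum_n_Sm (G := C_AbelianMonoid)) by lia. now rewrite Nat.add_succ_r.
Qed.

Lemma Crising_add s i m : Crising s (i + m) = Crising s i * Crising (s + RtoC (INR i)) m.
Proof.
induction m as [|m IH].
- rewrite Nat.add_0_r. simpl. ring.
- rewrite Nat.add_succ_r. simpl. rewrite IH, plus_INR, RtoC_plus. ring.
Qed.

Lemma Cfalling_nat i m :
  Cfalling (RtoC (INR (i + m))) i * RtoC (INR (fact m)) = RtoC (INR (fact (i + m))).
Proof.
induction i as [|i IH]; [simpl; ring|].
rewrite Cfalling_S_l. change (S i + m)%nat with (S (i + m)).
rewrite fact_simpl, mult_INR, RtoC_mult, <- IH, S_INR, RtoC_plus.
replace (INR (i + m) + 1 - 1) with (RtoC (INR (i + m))) by ring. ring.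
Qed.

Lemma Cbinom_nat_small k i : (k < i)%nat -> Cbinom (RtoC (INR k)) i = 0.
Proof.
intros H. unfold Cbinom. replace (Cfalling (RtoC (INR k)) i) with (RtoC 0); [unfold Cdiv; ring|].
induction H as [|i H IH]; simpl; [ring|]. rewrite <- IH. ring.
Qed.

Lemma Cbinom_nat k i : (i <= k)%nat -> Cbinom (RtoC (INR k)) i = RtoC (Binomial.C k i).
Proof.
intros H. replace k with (i + (k - i))%nat by lia. set (m := (k - i)%nat).
unfold Cbinom, Binomial.C. replace (i + m - i)%nat with m by lia.
rewrite RtoC_div, RtoC_mult by (apply Rmult_integral_contrapositive; split; apply INR_fact_neq_0).
rewrite <- Cfalling_nat. field. split; apply RtoC_INR_fact_neq_0.
Qed.

Lemma multichoose_Cbinom s i m :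
  multichoose s (i + m) * Cbinom (RtoC (INR (i + m))) i
  = multichoose s i * multichoose (s + RtoC (INR i)) m.
Proof.
unfold multichoose, Cbinom. rewrite Crising_add, <- Cfalling_nat.
assert (Hf : Cfalling (RtoC (INR (i + m))) i <> 0).
{ intros E. apply (RtoC_INR_fact_neq_0 (i + m)). rewrite <- Cfalling_nat, E. ring. }
field. repeat split; (assumption || apply RtoC_INR_fact_neq_0).
Qed.

Lemma Cbinom_multichoose s k : Cbinom (s + RtoC (INR k) - 1) k = multichoose s k.
Proof. unfold Cbinom, multichoose. now rewrite Cfalling_Crising. Qed.

Lemma sum_binomial_tail d :
  sum_f_R0 (fun l => Binomial.C (S d) (S l)) d = (2 ^ S d - 1)%R.
Proof.
assert (H := binomial 1 1 (S d)).
rewrite (sum_eq _ (fun i => Binomial.C (S d) i)) in H by (intros; rewrite !pow1; ring).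
rewrite decomp_sum in H by lia. simpl pred in H.
replace (1 + 1)%R with 2%R in H by ring.
assert (H0 : Binomial.C (S d) 0 = 1%R).
{ unfold Binomial.C. rewrite Nat.sub_0_r. simpl (INR (fact 0)).
  field. apply INR_fact_neq_0. }
rewrite H0 in H. lra.
Qed.

(** Trinomial revision, with the factor 1/(i+1) absorbed into binom(k,i). *)
Lemma binomial_product j d l : (l <= d)%nat ->
  (Binomial.C (j + d) (j + l) * Binomial.C (j + l + 1) j * (1 / INR (j + l + 1))
   = Binomial.C (j + d + 1) j / INR (j + d + 1) * Binomial.C (S d) (S l))%R.
Proof.
intros Hl. unfold Binomial.C.
replace (j + d - (j + l))%nat with (d - l)%nat by lia.
replace (j + l + 1 - j)%nat with (S l) by lia.
replace (j + d + 1 - j)%nat with (S d) by lia.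
replace (S d - S l)%nat with (d - l)%nat by lia.
replace (j + l + 1)%nat with (S (j + l)) by lia.
replace (j + d + 1)%nat with (S (j + d)) by lia.
rewrite (fact_simpl (j + l)), (fact_simpl (j + d)), !mult_INR.
assert (INR (S (j + l)) <> 0%R) by (apply not_0_INR; lia).
assert (INR (S (j + d)) <> 0%R) by (apply not_0_INR; lia).
field. repeat split; try apply INR_fact_neq_0; assumption.
Qed.

Lemma sum_binomial_products j d :
  sum_n_m (G := C_AbelianMonoid) (fun i : nat =>
     Cbinom (RtoC (INR (j + d))) i * Cbinom (RtoC (INR (i + 1))) j
       * (1 / RtoC (INR (i + 1)))) j (j + d)
  = RtoC (Binomial.C (j + d + 1) j / INR (j + d + 1) * (2 ^ S d - 1)) :> C.
Proof.
rewrite Csum_shift.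
rewrite (Csum_ext _ (fun l => RtoC (Binomial.C (j + d + 1) j / INR (j + d + 1)) * RtoC (Binomial.C (S d) (S l)))).
- rewrite Csum_mult_l, Csum_RtoC, sum_binomial_tail, RtoC_mult. reflexivity.
- intros l Hl. rewrite <- RtoC_mult, <- binomial_product by assumption.
  rewrite !Cbinom_nat by lia. rewrite !RtoC_mult, RtoC_div.
  + reflexivity.
  + apply not_0_INR; lia.
Qed.

Lemma is_Cseries_prepend_zeros (a : nat -> C) (l : C) i :
  (forall k, (k < i)%nat -> a k = 0) -> is_Cseries (fun m => a (i + m)%nat) l -> is_Cseries a l.
Proof.
revert a. induction i as [|i IH]; intros a Ha Hs; [exact Hs|].
apply (is_series_decr_1 (K := C_AbsRing) (V := C_NormedModule)).
match goal with |- is_series _ ?v => replace v with l end.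
2:{ rewrite Ha by lia. change (l = l + - (0)). ring. }
apply IH; [intros k Hk; apply Ha; lia | exact Hs].
Qed.

Lemma Rcpow_2_one_minus j : Rcpow 2 (1 - RtoC (INR j)) = RtoC (2 / 2 ^ j).
Proof.
unfold Cminus. rewrite Rcpow_plus, Rcpow_opp_nat by lra.
replace (RtoC 1) with (RtoC (INR 1)) by reflexivity. rewrite Rcpow_nat by lra.
rewrite RtoC_div, RtoC_pow by (apply pow_nonzero; lra).
rewrite Cpow_inv by (intros E; apply RtoC_inj in E; lra). simpl. unfold Cdiv. ring.
Qed.

Lemma Rcpow_2_shift s i : Rcpow 2 (s + RtoC (INR i)) = Rcpow 2 s * RtoC (2 ^ i).
Proof. rewrite Rcpow_plus, Rcpow_nat, RtoC_pow by lra. reflexivity. Qed.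

Lemma sum_binomial_bernoulli k :
  sum_f_R0 (fun j => Binomial.C (k + 1) j * bernoulli j)%R k = (if k then 1 else 0)%R.
Proof.
destruct k as [|k]; [|apply bernoulli_rec; lia].
simpl. unfold Binomial.C. simpl. rewrite bernoulli_0. field.
Qed.

(** * The Bernoulli numbers and the sum of the theorem *)

Section Reduction.
Variables (zeta : C -> C) (s : C).
Hypothesis Hzeta : is_riemann_zeta zeta.
Hypothesis regular : forall m, s + RtoC (INR m) <> 1.

Definition weight (j : nat) : C :=
  RtoC (bernoulli j) / (Rcpow 2 s - Rcpow 2 (1 - RtoC (INR j))).

(** The coordinates of the polynomial k -> [rhs_factor n k] in the basis of
    the binomials binom(k,i); they do not depend on n. *)
Definition binomial_coordinate (i : nat) : C :=
  Csum (fun j => weight j * (Cbinom (RtoC (INR (i + 1))) j * (1 / RtoC (INR (i + 1))))) i.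

Definition rhs_factor (n k : nat) : C :=
  Csum (fun j => weight j * sum_n_m (G := C_AbelianMonoid) (fun i : nat =>
     Cbinom (RtoC (INR k)) i * Cbinom (RtoC (INR (i + 1))) j
       * (1 / RtoC (INR (i + 1)))) j n) n.

Lemma rhs_factor_expansion n k :
  rhs_factor n k = Csum (fun i => Cbinom (RtoC (INR k)) i * binomial_coordinate i) n.
Proof.
induction n as [|n IH].
- unfold rhs_factor, binomial_coordinate. rewrite !Csum_0, (sum_n_n (G := C_AbelianMonoid)).
  change (weight 0 * (Cbinom (RtoC (INR k)) 0 * Cbinom (RtoC (INR (0 + 1))) 0 * (1 / RtoC (INR (0 + 1))))
   = Cbinom (RtoC (INR k)) 0 * (weight 0 * (Cbinom (RtoC (INR (0 + 1))) 0 * (1 / RtoC (INR (0 + 1)))))).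
  ring.
- rewrite Csum_S, <- IH. unfold rhs_factor at 1, binomial_coordinate. rewrite !Csum_S.
  rewrite (sum_n_n (G := C_AbelianMonoid)).
  rewrite (Csum_ext _ (fun j => weight j * sum_n_m (G := C_AbelianMonoid) (fun i : nat =>
     Cbinom (RtoC (INR k)) i * Cbinom (RtoC (INR (i + 1))) j
       * (1 / RtoC (INR (i + 1)))) j n + Cbinom (RtoC (INR k)) (S n) * (weight j *
       (Cbinom (RtoC (INR (S n + 1))) j * (1 / RtoC (INR (S n + 1))))))).
  + rewrite Csum_plus, Csum_mult_l. fold (rhs_factor n k).
    change (AbelianMonoid.sort C_AbelianMonoid) with C. ring.
  + intros j Hj. rewrite (sum_n_Sm (G := C_AbelianMonoid)) by lia.
    unfold plus; simpl. ring.
Qed.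

Definition zeta_term (k : nat) : C := multichoose s k * (zeta (s + RtoC (INR k)) / 2 ^ k).

(** By c(s,k) binom(k,i) = c(s,i) c(s+i,k-i) this is the half-shift formula at
    s + i; the terms with k < i vanish. *)
Lemma is_Cseries_binomial_moment i :
  is_Cseries (fun k => zeta_term k * Cbinom (RtoC (INR k)) i)
    (multichoose s i * (Rcpow 2 s - RtoC (/ 2 ^ i)) * zeta (s + RtoC (INR i))).
Proof.
apply (is_Cseries_prepend_zeros _ _ i).
{ intros k Hk. rewrite Cbinom_nat_small by assumption. ring. }
assert (H2 : RtoC (2 ^ i) <> 0).
{ intros E; apply RtoC_inj in E. revert E. apply pow_nonzero. lra. }
assert (H2' : forall n, RtoC 2 ^ n <> 0).
{ intros n. apply Cpow_nz. intros E; apply RtoC_inj in E; lra. }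
replace (multichoose s i * (Rcpow 2 s - RtoC (/ 2 ^ i)) * zeta (s + RtoC (INR i)))
  with (multichoose s i / RtoC (2 ^ i) * ((Rcpow 2 (s + RtoC (INR i)) - 1) * zeta (s + RtoC (INR i)))).
2:{ rewrite Rcpow_2_shift, RtoC_inv by (apply pow_nonzero; lra). field. assumption. }
eapply is_Cseries_ext; [|apply is_Cseries_mult, (zeta_half_shift zeta Hzeta)].
- intros m. cbv beta. unfold zeta_term.
  transitivity (multichoose s (i + m) * Cbinom (RtoC (INR (i + m))) i
    * (zeta (s + RtoC (INR (i + m))) / 2 ^ (i + m))); [|ring].
  rewrite multichoose_Cbinom, plus_INR, RtoC_plus, Cplus_assoc, Cpow_add_r, RtoC_pow.
  field. split; apply H2'.
- intros m. rewrite <- Cplus_assoc, <- RtoC_plus, <- plus_INR. apply regular.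
Qed.

Lemma is_Cseries_rhs_factor n :
  is_Cseries (fun k => zeta_term k * rhs_factor n k)
   (Csum (fun i => binomial_coordinate i *
      (multichoose s i * (Rcpow 2 s - RtoC (/ 2 ^ i)) * zeta (s + RtoC (INR i)))) n).
Proof.
apply (is_Cseries_ext (fun k => zeta_term k * Csum (fun i => Cbinom (RtoC (INR k)) i * binomial_coordinate i) n)).
{ intros k. now rewrite rhs_factor_expansion. }
induction n as [|n IH].
- rewrite Csum_0. eapply is_Cseries_ext; [|apply is_Cseries_mult, is_Cseries_binomial_moment].
  intros k. cbv beta. rewrite Csum_0. ring.
- rewrite Csum_S. eapply is_Cseries_ext;
    [|apply is_Cseries_plus; [exact IH | apply is_Cseries_mult, is_Cseries_binomial_moment]].
  intros k. cbv beta. rewrite Csum_S. ring.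
Qed.

(** Since binom(k,i) = 0 for i > k, enlarging the range of i does not change
    the value at k. *)
Lemma rhs_factor_triangular n k : (k <= n)%nat -> rhs_factor n k = rhs_factor k k.
Proof.
intros Hk. rewrite !rhs_factor_expansion.
induction Hk as [|n Hk IH]; [reflexivity|].
rewrite Csum_S, IH, Cbinom_nat_small by lia. ring.
Qed.

(** The coefficient of weight(j) is binom(k+1,j) / (k+1) times the difference
    of 2^s - 2^(-k) and 2^(-k) (2^(k+1-j) - 1), which is 2^s - 2^(1-j), the
    denominator of weight(j). What remains is the sum in the recursion of the
    Bernoulli numbers. *)
Lemma bernoulli_cancellation k :
  (forall j, (j <= k)%nat -> Rcpow 2 s <> Rcpow 2 (1 - RtoC (INR j))) ->
  binomial_coordinate k * (Rcpow 2 s - RtoC (/ 2 ^ k)) - rhs_factor k k * RtoC (/ 2 ^ k)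
   = RtoC (if k then 1 else 0)%R.
Proof.
intros Hden.
assert (Hk1 : INR (k + 1) <> 0%R) by (apply not_0_INR; lia).
replace (if k then 1 else 0)%R with (/ INR (k + 1) * (if k then 1 else 0))%R
  by (destruct k; simpl; field; try assumption).
rewrite <- (sum_binomial_bernoulli k), RtoC_mult, <- Csum_RtoC, <- Csum_mult_l.
unfold binomial_coordinate, rhs_factor.
rewrite (Cmult_comm _ (Rcpow 2 s - RtoC (/ 2 ^ k))), (Cmult_comm _ (RtoC (/ 2 ^ k))).
unfold Cminus at 1.
(* Bring both terms under one sum over j. *)
replace (- (RtoC (/ 2 ^ k) * Csum (fun j => weight j * sum_n_m (G := C_AbelianMonoid) (fun i : nat =>
     Cbinom (RtoC (INR k)) i * Cbinom (RtoC (INR (i + 1))) j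
       * (1 / RtoC (INR (i + 1)))) j k) k))
 with (- RtoC (/ 2 ^ k) * Csum (fun j => weight j * sum_n_m (G := C_AbelianMonoid) (fun i : nat =>
     Cbinom (RtoC (INR k)) i * Cbinom (RtoC (INR (i + 1))) j
       * (1 / RtoC (INR (i + 1)))) j k) k) by ring.
rewrite <- !Csum_mult_l, <- Csum_plus.
apply Csum_ext. intros j Hj.
replace k with (j + (k - j))%nat by lia. rewrite sum_binomial_products.
replace (j + (k - j))%nat with k by lia.
rewrite Cbinom_nat by lia.
unfold weight. rewrite Rcpow_2_one_minus.
assert (Hd : Rcpow 2 s - RtoC (2 / 2 ^ j) <> 0).
{ rewrite <- Rcpow_2_one_minus. intros E. apply (Hden j Hj).
  apply (f_equal (fun c => c + Rcpow 2 (1 - RtoC (INR j)))) in E. ring_simplify in E.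
  exact E. }
assert (H2k : (2 ^ k <> 0)%R) by (apply pow_nonzero; lra).
assert (Hpow : (2 / 2 ^ j = / 2 ^ k * 2 ^ S (k - j))%R).
{ replace (2 ^ k)%R with (2 ^ j * 2 ^ (k - j))%R by (rewrite <- pow_add; f_equal; lia).
  simpl. field. split; apply pow_nonzero; lra. }
set (q := RtoC (2 / 2 ^ j)) in *.
assert (Hq : q = RtoC (/ 2 ^ k) * RtoC (2 ^ S (k - j))) by (unfold q; rewrite Hpow; apply RtoC_mult).
set (N := RtoC (INR (k + 1))).
assert (HN : N <> 0) by (intros E; apply RtoC_inj in E; contradiction).
assert (H2kC : RtoC (2 ^ k) <> 0) by (intros E; apply RtoC_inj in E; contradiction).
rewrite (RtoC_mult (Binomial.C (k + 1) j / INR (k + 1))), (RtoC_mult (Binomial.C (k + 1) j)).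
rewrite RtoC_minus, (RtoC_div (Binomial.C (k + 1) j)), (RtoC_inv (INR (k + 1))) by assumption.
fold N.
replace (RtoC (2 ^ S (k - j))) with (q * RtoC (2 ^ k)).
2:{ rewrite Hq, (Cmult_comm (RtoC (/ 2 ^ k))), <- Cmult_assoc, <- RtoC_mult, Rinv_l by assumption. ring. }
rewrite RtoC_inv by assumption.
field. repeat split; assumption.
Qed.
End Reduction.

(** The points 1 - m with m < Delta are zeros of the denominators 2^s -
    2^(1-m). *)
Lemma rhs_defined_regular Delta s : rhs_defined Delta s -> forall m, s + RtoC (INR m) <> 1.
Proof.
intros [H1 H2] m E.
destruct (Nat.le_gt_cases Delta m) as [Hm|Hm]; [now apply (H1 m)|].
apply (H2 m ltac:(lia)). f_equal. rewrite <- E. ring.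
Qed.

Lemma is_rhs_sum_zeta zeta (Hzeta : is_riemann_zeta zeta) n s :
  rhs_defined (S n) s -> is_rhs_sum zeta (S n) s (zeta s).
Proof.
intros Hdef. assert (Hreg := rhs_defined_regular _ _ Hdef).
unfold is_rhs_sum.
apply (is_Cseries_ext (fun m => zeta_term zeta s (S n + m) * rhs_factor s n (S n + m))).
{ intros m. unfold rhs_term, zeta_term, rhs_factor, weight.
  rewrite Cbinom_multichoose. replace (S n - 1)%nat with n by lia. reflexivity. }
apply (is_series_incr_n (K := C_AbsRing) (V := C_NormedModule)
  (fun k => zeta_term zeta s k * rhs_factor s n k) (S n)); [lia|].
simpl pred.
match goal with |- is_series _ ?v => replace v with
  (Csum (fun i => binomial_coordinate s i *
      (multichoose s i * (Rcpow 2 s - RtoC (/ 2 ^ i)) * zeta (s + RtoC (INR i)))) n) end.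
{ now apply is_Cseries_rhs_factor. }
change (Csum (fun i => binomial_coordinate s i *
      (multichoose s i * (Rcpow 2 s - RtoC (/ 2 ^ i)) * zeta (s + RtoC (INR i)))) n
  = zeta s + Csum (fun k => zeta_term zeta s k * rhs_factor s n k) n :> C).
assert (Hk : forall k, (k <= n)%nat ->
  binomial_coordinate s k * (multichoose s k * (Rcpow 2 s - RtoC (/ 2 ^ k)) * zeta (s + RtoC (INR k)))
  = (if k then zeta s else 0) + zeta_term zeta s k * rhs_factor s n k).
{ intros k Hk.
  assert (Hb := bernoulli_cancellation s k).
  rewrite (rhs_factor_triangular s n k Hk). unfold zeta_term.
  assert (H2k : (2 ^ k <> 0)%R) by (apply pow_nonzero; lra).
  assert (Hb' := Hb ltac:(intros j Hj; apply Hdef; lia)).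
  transitivity (multichoose s k * zeta (s + RtoC (INR k)) *
    ((binomial_coordinate s k * (Rcpow 2 s - RtoC (/ 2 ^ k)) - rhs_factor s k k * RtoC (/ 2 ^ k))
     + rhs_factor s k k * RtoC (/ 2 ^ k))); [ring|].
  rewrite Hb', RtoC_inv, RtoC_pow by assumption.
  destruct k as [|k].
  - simpl INR. rewrite Cplus_0_r, multichoose_0. simpl. unfold Cdiv. ring.
  - unfold Cdiv. ring. }
assert (Hfirst : forall N, Csum (fun k => if k then zeta s else RtoC 0) N = zeta s :> C).
{ induction N as [|N IH]; [now rewrite Csum_0|]. rewrite Csum_S, IH. ring. }
now rewrite (Csum_ext _ _ n Hk), Csum_plus, Hfirst.
Qed.

Theorem theorem8 (zeta : C -> C) (Hzeta : is_riemann_zeta zeta)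
    (Delta : nat) (HDelta : (1 <= Delta)%nat) (s : C) (Hs : s <> 1) :
  (rhs_defined Delta s -> is_rhs_sum zeta Delta s (zeta s)) /\
  (~ rhs_defined Delta s ->
     exists rhs : C -> C,
       (forall s' : C, rhs_defined Delta s' ->
          is_rhs_sum zeta Delta s' (rhs s')) /\
       filterlim (U := C_UniformSpace) rhs
         (within (rhs_defined Delta) (locally (T := C_UniformSpace) s))
         (locally (T := C_UniformSpace) (zeta s))).
Proof.
destruct Delta as [|n]; [lia|].
split; [now apply is_rhs_sum_zeta|]. intros _.
exists zeta. split; [intros s'; now apply is_rhs_sum_zeta|].
apply filterlim_locally. intros eps.
destruct (Cderiv_continuous zeta s) with (eps := pos eps) as (d & Hd & Hcont);
  [now apply ex_Cderiv_zeta | apply cond_pos|].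
unfold within.
exists (mkposreal (d / 2) ltac:(lra)). intros w [Hw1 Hw2] _.
apply (C_NormedModule_mixin_compat1 (zeta s) (zeta w)).
change (Cmod (zeta w - zeta s) < eps)%R. apply Hcont.
eapply Rle_lt_trans; [apply Cmod_le_Re_Im|].
change (Rabs (Re w - Re s) < d / 2)%R in Hw1.
change (Rabs (Im w - Im s) < d / 2)%R in Hw2.
replace (Re (w - s)) with (Re w - Re s)%R by reflexivity.
replace (Im (w - s)) with (Im w - Im s)%R by reflexivity. lra.
Qed.
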